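(* Let $\psi$ be an analytic function on $\mathbb{D}$ inducing an isometric multiplication operator on the Bloch space $\mathcal{B}$ (so that $\psi$ is a constant $\eta$ of modulus $1$), and let $\varphi$ be an analytic self-map of $\mathbb{D}$ inducing an isometric composition operator on $\mathcal{B}$. If $\varphi$ is not a rotation, then $\sigma(W_{\psi,\varphi})=\overline{\mathbb{D}}$. If $\varphi(z)=\zeta z$ with $|\zeta|=1$, then $$\sigma(W_{\psi,\varphi}) = \begin{cases}\partial\mathbb{D} & \text{if } \mathrm{ord}(\zeta)=\infty,\\ \eta\langle\zeta\rangle & \text{if } \mathrm{ord}(\zeta)<\infty,\end{cases}$$ where $\eta\langle\zeta\rangle = \{\eta\zeta^k : k=1,\dots,n\}$ with $n=\mathrm{ord}(\zeta)$.
   Context: $\mathbb{D}$ is the open unit disk in $\mathbb{C}$. For $f$ analytic on $\mathbb{D}$, put $\beta_f = \sup_{z\in\mathbb{D}} (1-|z|^2)|f'(z)|$. The Bloch space $\mathcal{B}$ is the complex Banach space of analytic functions $f$ on $\mathbb{D}$ with $\beta_f<\infty$, with norm $\|f\|_{\mathcal{B}} = |f(0)|+\beta_f$. The multiplication, composition and weighted composition operators are $M_\psi(f)=\psi f$, $C_\varphi(f)=f\circ\varphi$ and $W_{\psi,\varphi}(f)=\psi\,(f\circ\varphi)$. An operator $T$ is isometric on $\mathcal{B}$ if it maps $\mathcal{B}$ into $\mathcal{B}$ and $\|Tf\|_{\mathcal{B}}=\|f\|_{\mathcal{B}}$ for all $f\in\mathcal{B}$ (surjectivity is not required). The paper shows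 that $M_\psi$ is isometric on $\mathcal{B}$ if and only if $\psi$ is a constant function of modulus $1$. A rotation is a map $z\mapsto\zeta z$ with $|\zeta|=1$. $\sigma(T)=\{\lambda\in\mathbb{C}: T-\lambda I \text{ is not invertible}\}$ denotes the spectrum of a bounded operator $T$ on $\mathcal{B}$. For $|\zeta|=1$, $\mathrm{ord}(\zeta)$ is the smallest positive integer $n$ with $\zeta^n=1$, and $\mathrm{ord}(\zeta)=\infty$ if no such $n$ exists; $\langle\zeta\rangle$ is the cyclic group generated by $\zeta$. *)

(* Defs.v *)
From Stdlib Require Import Reals Lra Lia FunctionalExtensionality ProofIrrelevance.
From Coquelicot Require Import Coquelicot.
Open Scope R_scope.

(** Functions on the unit disk are represented by total functions [C -> C];
    only their values on [disk] matter in [analytic], [bloch_seminorm],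
    [in_bloch] and [bloch_norm]. *)

Definition disk (z : C) : Prop := Cmod z < 1.

Definition analytic (f : C -> C) : Prop :=
  forall z, disk z -> ex_derive (K := C_AbsRing) (V := C_NormedModule) f z.

(** [C_derive f z] is the complex derivative only where [f] is complex
    differentiable ([C_derive_correct]), which [in_bloch] ensures on [disk]. *)
Definition bloch_seminorm (f : C -> C) : Rbar :=
  Lub_Rbar (fun r => exists z, disk z /\ r = (1 - Cmod z ^ 2) * Cmod (C_derive f z)).

Definition in_bloch (f : C -> C) : Prop :=
  analytic f /\ Rbar_lt (bloch_seminorm f) p_infty.

Definition bloch_norm (f : C -> C) : R :=
  Cmod (f (RtoC 0)) + real (bloch_seminorm f).

Lemma disk_0 : disk (RtoC 0).
Proof. unfold disk; rewrite Cmod_0; lra. Qed.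

Lemma disk_dec (z : C) : {disk z} + {~ disk z}.
Proof. apply Rlt_dec. Qed.

Lemma disk_weight (z : C) : disk z -> 0 < 1 - Cmod z ^ 2.
Proof. unfold disk; intros H; pose proof (Cmod_ge_0 z); nra. Qed.

Lemma disk_locally (z : C) : disk z -> locally (T := AbsRing_UniformSpace C_AbsRing) z disk.
Proof.
intros Hz; unfold disk in *.
assert (He : 0 < 1 - Cmod z) by lra.
exists (mkposreal _ He); intros y Hy.
change (Cmod (y - z)%C < 1 - Cmod z) in Hy.
replace y with ((y - z) + z)%C by ring.
pose proof (Cmod_triangle (y - z)%C z); lra.
Qed.

Lemma seminorm_ge (f : C -> C) (z : C) : in_bloch f -> disk z ->
  (1 - Cmod z ^ 2) * Cmod (C_derive f z) <= real (bloch_seminorm f).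
Proof.
intros [_ Hf] Hz; unfold bloch_seminorm in *.
match goal with |- context [Lub_Rbar ?E] =>
  destruct (Lub_Rbar_correct E) as [Hub _]; revert Hf Hub;
  destruct (Lub_Rbar E); simpl; intros Hf Hub end.
- apply (Hub _ (ex_intro _ z (conj Hz eq_refl))).
- destruct Hf.
- destruct (Hub _ (ex_intro _ z (conj Hz eq_refl))).
Qed.

Lemma seminorm_le (f : C -> C) (M : R) :
  (forall z, disk z -> (1 - Cmod z ^ 2) * Cmod (C_derive f z) <= M) ->
  Rbar_lt (bloch_seminorm f) p_infty /\ real (bloch_seminorm f) <= M.
Proof.
intros HM; unfold bloch_seminorm.
match goal with |- context [Lub_Rbar ?E] =>
  destruct (Lub_Rbar_correct E) as [Hub Hl] end.
assert (HM' : Rbar_le (Lub_Rbar (fun r => exists z, disk z /\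
   r = (1 - Cmod z ^ 2) * Cmod (C_derive f z))) M).
{ apply Hl; intros r [z [Hz ->]]; apply HM, Hz. }
specialize (Hub _ (ex_intro _ _ (conj disk_0 eq_refl))).
revert HM' Hub; destruct (Lub_Rbar _); simpl; intros; tauto.
Qed.

Lemma seminorm_ge_0 (f : C -> C) : in_bloch f -> 0 <= real (bloch_seminorm f).
Proof.
intros Hf; refine (Rle_trans _ _ _ _ (seminorm_ge f _ Hf disk_0)).
apply Rmult_le_pos; [apply Rlt_le, disk_weight, disk_0 | apply Cmod_ge_0].
Qed.

Lemma analytic_derive (f : C -> C) (z : C) : analytic f -> disk z ->
  is_derive (K := C_AbsRing) (V := C_NormedModule) f z (C_derive f z).
Proof. intros Hf Hz; apply C_derive_correct; auto. Qed.

Lemma derive_ext_disk (f g : C -> C) (z l : C) :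
  (forall w, disk w -> f w = g w) -> disk z ->
  is_derive (K := C_AbsRing) (V := C_NormedModule) f z l ->
  is_derive (K := C_AbsRing) (V := C_NormedModule) g z l.
Proof.
intros Hfg Hz; apply is_derive_ext_loc.
generalize (disk_locally z Hz); apply filter_imp; exact Hfg.
Qed.

Lemma in_bloch_of_derive (f : C -> C) (f' : C -> C) (M : R) :
  (forall z, disk z -> is_derive (K := C_AbsRing) (V := C_NormedModule) f z (f' z)) ->
  (forall z, disk z -> (1 - Cmod z ^ 2) * Cmod (f' z) <= M) ->
  in_bloch f /\ real (bloch_seminorm f) <= M.
Proof.
intros Hf HM.
destruct (seminorm_le f M) as [H1 H2].
{ intros z Hz; rewrite (is_C_derive_unique f z _ (Hf z Hz)); auto. }
split; [split|]; auto.
intros z Hz; exists (f' z); auto.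
Qed.

Lemma in_bloch_ext (f g : C -> C) : (forall z, disk z -> f z = g z) ->
  in_bloch f -> in_bloch g /\ bloch_norm g <= bloch_norm f.
Proof.
intros Hfg Hf.
destruct (in_bloch_of_derive g (C_derive f) (real (bloch_seminorm f))) as [H1 H2].
- intros z Hz; apply (derive_ext_disk f); auto.
  apply analytic_derive; auto; apply Hf.
- intros z Hz; apply seminorm_ge; auto.
- split; auto; unfold bloch_norm; rewrite (Hfg _ disk_0); lra.
Qed.

(** The Bloch space.  Requiring the value 0 off the disk makes Leibniz equality
    coincide with equality on the disk ([bloch_ext]). *)
Record bloch : Type := Bloch {
  bloch_fun :> C -> C;
  bloch_in : in_bloch bloch_fun;
  bloch_off : forall z, ~ disk z -> bloch_fun z = RtoC 0
}.

Lemma bloch_ext (f g : bloch) : (forall z, disk z -> f z = g z) -> f = g.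
Proof.
destruct f as [f f1 f2], g as [g g1 g2]; simpl; intros H.
assert (E : f = g).
{ apply functional_extensionality; intros z.
  destruct (disk_dec z); [auto | rewrite f2, g2; auto]. }
subst g; f_equal; apply proof_irrelevance.
Qed.

Definition restrict (f : C -> C) (z : C) : C :=
  if disk_dec z then f z else RtoC 0.

Lemma restrict_on (f : C -> C) z : disk z -> restrict f z = f z.
Proof. unfold restrict; destruct (disk_dec z); tauto. Qed.

Lemma restrict_off (f : C -> C) z : ~ disk z -> restrict f z = RtoC 0.
Proof. unfold restrict; destruct (disk_dec z); tauto. Qed.

Lemma in_bloch_restrict (f : C -> C) : in_bloch f -> in_bloch (restrict f).
Proof.
intros Hf; apply (in_bloch_ext f); auto.
intros; rewrite restrict_on; auto.
Qed.

Definition to_bloch (f : C -> C) (Hf : in_bloch f) : bloch :=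
  Bloch (restrict f) (in_bloch_restrict f Hf) (restrict_off f).

Lemma to_bloch_on (f : C -> C) Hf z : disk z -> to_bloch f Hf z = f z.
Proof. apply restrict_on. Qed.

Lemma bloch_norm_to_bloch (f : C -> C) Hf : bloch_norm (to_bloch f Hf) = bloch_norm f.
Proof.
apply Rle_antisym.
- apply in_bloch_ext; auto; intros; symmetry; apply restrict_on; auto.
- apply in_bloch_ext; [intros; apply restrict_on; auto|].
  apply in_bloch_restrict, Hf.
Qed.

Lemma in_bloch_0 : in_bloch (fun _ => RtoC 0).
Proof.
apply (in_bloch_of_derive _ (fun _ => RtoC 0) 0).
- intros z _; apply (is_derive_const (K := C_AbsRing) (V := C_NormedModule)).
- intros z _; rewrite Cmod_0; lra.
Qed.

Lemma bloch_plus_spec (f g : C -> C) : in_bloch f -> in_bloch g ->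
  in_bloch (fun z => f z + g z)%C /\
  bloch_norm (fun z => f z + g z)%C <= bloch_norm f + bloch_norm g.
Proof.
intros Hf Hg.
destruct (in_bloch_of_derive (fun z => f z + g z)%C
  (fun z => C_derive f z + C_derive g z)%C
  (real (bloch_seminorm f) + real (bloch_seminorm g))) as [H1 H2].
- intros z Hz; apply (is_derive_plus (K := C_AbsRing) (V := C_NormedModule));
  apply analytic_derive; auto; [apply Hf | apply Hg].
- intros z Hz.
  pose proof (seminorm_ge f z Hf Hz); pose proof (seminorm_ge g z Hg Hz).
  pose proof (Cmod_triangle (C_derive f z) (C_derive g z)).
  pose proof (disk_weight z Hz); nra.
- split; auto; unfold bloch_norm.
  pose proof (Cmod_triangle (f (RtoC 0)) (g (RtoC 0))); lra.
Qed.

Lemma bloch_scal_spec (a : C) (f : C -> C) : in_bloch f ->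
  in_bloch (fun z => a * f z)%C /\
  bloch_norm (fun z => a * f z)%C <= Cmod a * bloch_norm f.
Proof.
intros Hf.
destruct (in_bloch_of_derive (fun z => a * f z)%C (fun z => a * C_derive f z)%C
  (Cmod a * real (bloch_seminorm f))) as [H1 H2].
- intros z Hz.
  apply (filterdiff_ext_lin (K := C_AbsRing) (U := AbsRing_NormedModule C_AbsRing)
           (V := C_NormedModule) _ (fun y : C => scal a (scal y (C_derive f z)))).
  + apply (filterdiff_comp' (K := C_AbsRing) (U := AbsRing_NormedModule C_AbsRing)
           (V := C_NormedModule) (W := C_NormedModule) f (fun y : C => scal a y)).
    * apply analytic_derive; auto; apply Hf.
    * exact (filterdiff_linear _
        (is_linear_scal_r (K := C_AbsRing) (V := C_NormedModule) a Cmult_comm)).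
  + intros y; change (a * (y * C_derive f z) = y * (a * C_derive f z))%C; ring.
- intros z Hz; rewrite Cmod_mult.
  pose proof (seminorm_ge f z Hf Hz); pose proof (Cmod_ge_0 a); nra.
- split; auto; unfold bloch_norm; rewrite Cmod_mult; nra.
Qed.

Definition bloch_zero : bloch := to_bloch _ in_bloch_0.
Definition bloch_plus (f g : bloch) : bloch :=
  to_bloch _ (proj1 (bloch_plus_spec f g (bloch_in f) (bloch_in g))).
Definition bloch_scal (a : C) (f : bloch) : bloch :=
  to_bloch _ (proj1 (bloch_scal_spec a f (bloch_in f))).
Definition bloch_opp (f : bloch) : bloch := bloch_scal (RtoC (-1)) f.

Lemma bloch_zero_on z : disk z -> bloch_zero z = RtoC 0.
Proof. exact (to_bloch_on _ _ z). Qed.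
Lemma bloch_plus_on (f g : bloch) z : disk z -> bloch_plus f g z = (f z + g z)%C.
Proof. exact (to_bloch_on _ _ z). Qed.
Lemma bloch_scal_on (a : C) (f : bloch) z : disk z -> bloch_scal a f z = (a * f z)%C.
Proof. exact (to_bloch_on _ _ z). Qed.
Lemma bloch_opp_on (f : bloch) z : disk z -> bloch_opp f z = (- f z)%C.
Proof. intros Hz; unfold bloch_opp; rewrite bloch_scal_on; auto; ring. Qed.

Ltac bloch_ring := intros; apply bloch_ext; intros z Hz;
  rewrite ?bloch_plus_on, ?bloch_zero_on, ?bloch_opp_on, ?bloch_scal_on,
    ?bloch_plus_on, ?bloch_scal_on by assumption; try ring.

Lemma bloch_plus_comm (f g : bloch) : bloch_plus f g = bloch_plus g f.
Proof. bloch_ring. Qed.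
Lemma bloch_plus_assoc (f g h : bloch) :
  bloch_plus f (bloch_plus g h) = bloch_plus (bloch_plus f g) h.
Proof. bloch_ring. Qed.
Lemma bloch_plus_zero (f : bloch) : bloch_plus f bloch_zero = f.
Proof. bloch_ring. Qed.
Lemma bloch_plus_opp (f : bloch) : bloch_plus f (bloch_opp f) = bloch_zero.
Proof. bloch_ring. Qed.

Definition bloch_AbelianMonoid_mixin :=
  AbelianMonoid.Mixin bloch _ _ bloch_plus_comm bloch_plus_assoc bloch_plus_zero.
Canonical bloch_AbelianMonoid := AbelianMonoid.Pack bloch bloch_AbelianMonoid_mixin bloch.
Definition bloch_AbelianGroup_mixin :=
  AbelianGroup.Mixin bloch_AbelianMonoid _ bloch_plus_opp.
Canonical bloch_AbelianGroup :=
  AbelianGroup.Pack bloch (AbelianGroup.Class _ _ bloch_AbelianGroup_mixin) bloch.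

Lemma bloch_scal_assoc (a b : C) (f : bloch) :
  bloch_scal a (bloch_scal b f) = bloch_scal (a * b)%C f.
Proof. bloch_ring. Qed.
Lemma bloch_scal_one (f : bloch) : bloch_scal (RtoC 1) f = f.
Proof. bloch_ring. Qed.
Lemma bloch_scal_distr_l (a : C) (f g : bloch) :
  bloch_scal a (bloch_plus f g) = bloch_plus (bloch_scal a f) (bloch_scal a g).
Proof. bloch_ring. Qed.
Lemma bloch_scal_distr_r (a b : C) (f : bloch) :
  bloch_scal (a + b)%C f = bloch_plus (bloch_scal a f) (bloch_scal b f).
Proof. bloch_ring. Qed.

Definition bloch_ModuleSpace_mixin :=
  ModuleSpace.Mixin C_Ring bloch_AbelianGroup _
    bloch_scal_assoc bloch_scal_one bloch_scal_distr_l bloch_scal_distr_r.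
Canonical bloch_ModuleSpace :=
  ModuleSpace.Pack C_Ring bloch (ModuleSpace.Class _ _ _ bloch_ModuleSpace_mixin) bloch.

Lemma bloch_norm_plus (f g : bloch) :
  bloch_norm (bloch_plus f g) <= bloch_norm f + bloch_norm g.
Proof.
unfold bloch_plus; rewrite bloch_norm_to_bloch; apply bloch_plus_spec; apply bloch_in.
Qed.

Lemma bloch_norm_scal (a : C) (f : bloch) :
  bloch_norm (bloch_scal a f) <= Cmod a * bloch_norm f.
Proof.
unfold bloch_scal; rewrite bloch_norm_to_bloch; apply bloch_scal_spec; apply bloch_in.
Qed.

Lemma bloch_norm_ge_0 (f : bloch) : 0 <= bloch_norm f.
Proof.
unfold bloch_norm; pose proof (seminorm_ge_0 f (bloch_in f)).
pose proof (Cmod_ge_0 (f (RtoC 0))); lra.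
Qed.

Lemma bloch_norm_zero : bloch_norm bloch_zero = 0.
Proof.
apply Rle_antisym; [|apply bloch_norm_ge_0].
replace bloch_zero with (bloch_scal (RtoC 0) bloch_zero) by bloch_ring.
pose proof (bloch_norm_scal (RtoC 0) bloch_zero); rewrite Cmod_0 in *; lra.
Qed.

Definition bloch_ball (f : bloch) (e : R) (g : bloch) : Prop :=
  bloch_norm (minus g f) < e.

Lemma bloch_ball_center (f : bloch) (e : posreal) : bloch_ball f e f.
Proof.
unfold bloch_ball; rewrite minus_eq_zero.
change (bloch_norm bloch_zero < e); rewrite bloch_norm_zero; apply cond_pos.
Qed.

Lemma bloch_ball_sym (f g : bloch) (e : R) : bloch_ball f e g -> bloch_ball g e f.
Proof.
unfold bloch_ball; intros H.
replace (minus f g) with (bloch_scal (RtoC (-1)) (minus g f)).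
- pose proof (bloch_norm_scal (RtoC (-1)) (minus g f)) as H1.
  rewrite Cmod_R, Rabs_left in H1; lra.
- change (bloch_opp (minus g f) = minus f g).
  change (opp (minus g f) = minus f g); apply opp_minus.
Qed.

Lemma bloch_ball_triangle (f g h : bloch) (e1 e2 : R) :
  bloch_ball f e1 g -> bloch_ball g e2 h -> bloch_ball f (e1 + e2) h.
Proof.
unfold bloch_ball; intros H1 H2.
rewrite (minus_trans g h f).
pose proof (bloch_norm_plus (minus h g) (minus g f)) as H.
eapply Rle_lt_trans; [exact H|lra].
Qed.

Definition bloch_UniformSpace_mixin :=
  UniformSpace.Mixin bloch bloch_zero bloch_ball
    bloch_ball_center bloch_ball_sym bloch_ball_triangle.
Canonical bloch_UniformSpace := UniformSpace.Pack bloch bloch_UniformSpace_mixin bloch.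
Canonical bloch_NormedModuleAux :=
  NormedModuleAux.Pack C_AbsRing bloch
    (NormedModuleAux.Class C_AbsRing bloch (ModuleSpace.class C_Ring bloch_ModuleSpace)
       bloch_UniformSpace_mixin) bloch.

Lemma zero_derive_line (f : C -> C) (z : C) (t : R) (p : C -> R) :
  (forall u v, Rabs (p u - p v) <= Cmod (u - v)%C) ->
  Cmod z < 1 ->
  is_derive (K := C_AbsRing) (V := C_NormedModule) f (t * z)%C (RtoC 0) ->
  is_derive (fun s : R => p (f (s * z)%C)) t 0.
Proof.
intros Hp Hz [_ Hd]; apply is_derive_Reals; intros eps Heps.
assert (He2 : 0 < eps / 2) by lra.
destruct (Hd (t * z)%C (fun P HP => HP) (mkposreal _ He2)) as [d Hd'].
exists d; intros h Hh0 Hh.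
assert (E : ((t + h)%R * z - t * z = h * z)%C) by (rewrite RtoC_plus; ring).
specialize (Hd' ((t + h)%R * z)%C).
assert (B : Cmod ((t + h)%R * z - t * z)%C <= Rabs h).
{ rewrite E, Cmod_mult, Cmod_R; pose proof (Rabs_pos h); nra. }
assert (Hball : @ball (AbsRing_UniformSpace C_AbsRing) (t * z)%C d ((t + h)%R * z)%C).
{ change (Cmod ((t + h)%R * z - t * z)%C < d); lra. }
specialize (Hd' Hball).
change (Cmod (f ((t + h)%R * z) - f (t * z) - ((t + h)%R * z - t * z) * 0)%C
        <= eps / 2 * Cmod ((t + h)%R * z - t * z)%C) in Hd'.
rewrite Cmult_0_r in Hd'.
replace (f ((t + h)%R * z) - f (t * z) - 0)%C with (f ((t + h)%R * z) - f (t * z))%C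
  in Hd' by ring.
pose proof (Hp (f ((t + h)%R * z)%C) (f (t * z)%C)) as Hpp.
pose proof (Rabs_pos_lt h Hh0) as Hha.
rewrite Rminus_0_r; unfold Rdiv; rewrite Rabs_mult, Rabs_inv.
apply (Rmult_lt_reg_r (Rabs h)); auto.
rewrite Rmult_assoc, Rinv_l, Rmult_1_r by lra.
nra.
Qed.

Lemma bloch_norm_eq_0 (f : bloch) : bloch_norm f = 0 -> f = bloch_zero.
Proof.
intros H; unfold bloch_norm in H.
pose proof (bloch_in f) as Hf.
pose proof (seminorm_ge_0 f Hf); pose proof (Cmod_ge_0 (f (RtoC 0))).
assert (Hf0 : f (RtoC 0) = RtoC 0) by (apply Cmod_eq_0; lra).
apply bloch_ext; intros z Hz; rewrite bloch_zero_on by auto.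
assert (Hl : forall p : C -> R, (forall u v, Rabs (p u - p v) <= Cmod (u - v)%C) ->
  p (f (RtoC 0)) = p (f z)).
{ intros p Hp.
  replace (f z) with (f (RtoC 1 * z)%C) by (f_equal; ring).
  replace (f (RtoC 0)) with (f (RtoC 0 * z)%C) by (f_equal; ring).
  apply (eq_is_derive (fun s : R => p (f (s * z)%C)) 0 1); [|lra].
  intros t Ht; apply (zero_derive_line f z t p Hp Hz).
  assert (Hd : disk (t * z)%C).
  { unfold disk in *; rewrite Cmod_mult, Cmod_R, Rabs_pos_eq by lra.
    pose proof (Cmod_ge_0 z); nra. }
  replace (RtoC 0) with (C_derive f (t * z)%C).
  - apply analytic_derive; auto; apply Hf.
  - apply Cmod_eq_0.
    pose proof (seminorm_ge f _ Hf Hd); pose proof (disk_weight _ Hd).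
    pose proof (Cmod_ge_0 (C_derive f (t * z)%C)); nra. }
rewrite Hf0 in Hl; symmetry; apply injective_projections.
- apply (Hl fst); intros u v.
  eapply Rle_trans; [|apply Rmax_Cmod]; apply Rmax_l.
- apply (Hl snd); intros u v.
  eapply Rle_trans; [|apply Rmax_Cmod]; apply Rmax_r.
Qed.

Definition bloch_NormedModule_mixin :=
  NormedModule.Mixin C_AbsRing bloch_NormedModuleAux (fun f : bloch => bloch_norm f) 1
    bloch_norm_plus bloch_norm_scal
    (fun f g e H => H)
    (fun f g e H => eq_ind_r (fun r => bloch_norm (minus g f) < r) H (Rmult_1_l e))
    bloch_norm_eq_0.
Canonical bloch_NormedModule : NormedModule C_AbsRing :=
  NormedModule.Pack C_AbsRing bloch
    (NormedModule.Class C_AbsRing bloch _ bloch_NormedModule_mixin) bloch.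

Definition mul_op (psi : C -> C) (f : C -> C) : C -> C := fun z => (psi z * f z)%C.
Definition comp_op (phi : C -> C) (f : C -> C) : C -> C := fun z => f (phi z).
Definition wcomp_op (psi phi : C -> C) (f : C -> C) : C -> C :=
  fun z => (psi z * f (phi z))%C.

Definition maps_bloch (T : (C -> C) -> (C -> C)) : Prop :=
  forall f, in_bloch f -> in_bloch (T f).

Definition isometric_on_bloch (T : (C -> C) -> (C -> C)) : Prop :=
  maps_bloch T /\ forall f, in_bloch f -> bloch_norm (T f) = bloch_norm f.

Definition bloch_op (T : (C -> C) -> (C -> C)) (HT : maps_bloch T) (f : bloch) : bloch :=
  to_bloch (T f) (HT f (bloch_in f)).

Lemma wcomp_maps (psi phi : C -> C) :
  isometric_on_bloch (mul_op psi) -> isometric_on_bloch (comp_op phi) ->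
  maps_bloch (wcomp_op psi phi).
Proof. intros [HM _] [HC _] f Hf; exact (HM _ (HC _ Hf)). Qed.

(** Invertibility in the algebra of bounded linear operators: [is_linear]
    includes boundedness. *)
Definition invertible {V : NormedModule C_AbsRing} (T : V -> V) : Prop :=
  exists S : V -> V,
    is_linear S /\ (forall x, S (T x) = x) /\ (forall x, T (S x) = x).

Definition spectrum {V : NormedModule C_AbsRing} (T : V -> V) (lambda : C) : Prop :=
  ~ invertible (fun x : V => minus (T x) (scal lambda x)).

Definition is_rotation (phi : C -> C) : Prop :=
  exists zeta, Cmod zeta = 1 /\ forall z, disk z -> phi z = (zeta * z)%C.

Definition has_order (zeta : C) (n : nat) : Prop :=
  (0 < n)%nat /\ Cpow zeta n = RtoC 1 /\
  forall m, (0 < m < n)%nat -> Cpow zeta m <> RtoC 1.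

Definition infinite_order (zeta : C) : Prop :=
  forall n, (0 < n)%nat -> Cpow zeta n <> RtoC 1.

(* Main.v *)
Require Import Defs.
From Stdlib Require Import ZArith List FinFun Lra Lia.
From Stdlib Require Import FunctionalExtensionality ClassicalEpsilon.
From Stdlib Require Import Reals.
From Coquelicot Require Import Coquelicot.
Open Scope R_scope.

(** Write [beta f] for the Bloch seminorm and [rho r] for the hyperbolic distance from 0 to
    a point of modulus [r].  Everything rests on the growth bound
    [|f z - f 0| <= beta f * rho |z|], which is integration along a radius
    ([bloch_growth]), and on its sharpness ([bloch_growth_sharp]): equality is attained in
    the limit by the partial sums of the rotated inverse hyperbolic tangent.

    The symbol [psi] is a unimodular constant ([isometric_mul_const]).  Since all powers of
    [psi] have norm 1, the growth bound gives [|psi| <= 1]; multiplying [psi] by extremal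
    functions shows that [(1 - |z|^2) |psi'(z)|] tends to 0 at the boundary.  The isometry
    applied to [z^k + 1] requires a point where both [psi'] and [(psi z^k)'] are almost
    extremal; for large [k] there is none, unless [beta psi = 0].

    Testing the isometry on [z + c] gives [phi 0 = 0].  If composition with [phi] is onto,
    comparing sharp growth at [z] and at [phi z] in both directions gives [|phi z| = |z|]
    ([isometric_comp_onto_Cmod]); then [z phi'(z) = phi z], so [phi] is linear along radii,
    hence a rotation ([Cmod_preserving_rotation]).  Thus [W] is not onto if [phi] is not a
    rotation.

    For an isometry [T] of a complete space, [T - lambda] is bounded below when
    [|lambda| < 1], so invertibility of one such operator spreads to all of the open disk,
    and in particular to [T]; if [T] is not onto the spectrum is therefore the closed disk,
    and if [T] is onto the spectrum lies on the circle ([spectrum_isometry_not_onto],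
    [spectrum_isometry_onto]).  The Bloch space is complete ([bloch_complete]) because
    bounds on differences of derivatives integrate to bounds on differences of increments.

    When [phi] is the rotation by [zeta], the monomial [z^k] is an eigenvector of [W] with
    eigenvalue [eta zeta^k].  If [zeta] has infinite order, these eigenvalues are dense in
    the circle ([infinite_order_dense]).  If [zeta] has order [n], then [W^n = eta^n], so a
    spectral value [lambda] satisfies [lambda^n = eta^n], and the roots of this equation
    are the [eta zeta^k]. *)

(** * Complex derivatives and growth along segments *)

Notation cderiv f z l := (is_derive (K := C_AbsRing) (V := C_NormedModule) f z l).

(** [C] carries two normed module structures with the same norm and different uniform
    structures; the product rule takes its values in the absolute ring. *)
Lemma cderiv_AbsRing (f : C -> C) (z l : C) :
  cderiv f z l <->
  is_derive (K := C_AbsRing) (V := AbsRing_NormedModule C_AbsRing) f z l.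
Proof.
split; intros [[H1 H2 H3] H]; (split; [split; [exact H1 | exact H2 | exact H3] | exact H]).
Qed.

Lemma cderiv_eps (f : C -> C) (z l : C) : cderiv f z l <->
  (forall e, 0 < e -> exists d, 0 < d /\ forall w, Cmod (w - z)%C < d ->
     Cmod (f w - f z - (w - z) * l)%C <= e * Cmod (w - z)%C).
Proof.
split.
- intros [_ H] e He.
  destruct (H z (fun P HP => HP) (mkposreal _ He)) as [d Hd].
  exists d; split; [apply cond_pos|]; intros w Hw; exact (Hd w Hw).
- intros H; split.
  + apply (is_linear_scal_l (K := C_AbsRing) (V := C_NormedModule)).
  + intros x Hx e.
    assert (Ez : z = x) by exact (is_filter_lim_locally_unique _ _ Hx).
    subst x; destruct (H e (cond_pos e)) as [d [Hd Hw]].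
    exists (mkposreal _ Hd); intros w Hball; exact (Hw w Hball).
Qed.

Lemma cderiv_mult (f g : C -> C) (z a b : C) : cderiv f z a -> cderiv g z b ->
  cderiv (fun w => f w * g w)%C z (a * g z + f z * b)%C.
Proof.
rewrite !cderiv_AbsRing; intros Hf Hg.
exact (is_derive_mult f g z a b Hf Hg Cmult_comm).
Qed.

Lemma cderiv_comp (f g : C -> C) (z a b : C) : cderiv f (g z) a -> cderiv g z b ->
  cderiv (fun w => f (g w)) z (b * a)%C.
Proof.
intros Hf Hg; apply cderiv_AbsRing in Hg.
exact (is_derive_comp (K := C_AbsRing) (V := C_NormedModule) f g z a b Hf Hg).
Qed.

Lemma cderiv_id (z : C) : cderiv (fun w => w) z (RtoC 1).
Proof.
apply cderiv_AbsRing, (is_derive_id (K := C_AbsRing)).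
Qed.

Lemma cderiv_const (c z : C) : cderiv (fun _ => c) z (RtoC 0).
Proof. apply (is_derive_const (K := C_AbsRing) (V := C_NormedModule)). Qed.

Lemma cderiv_plus (f g : C -> C) (z a b : C) : cderiv f z a -> cderiv g z b ->
  cderiv (fun w => f w + g w)%C z (a + b)%C.
Proof. apply (is_derive_plus (K := C_AbsRing) (V := C_NormedModule)). Qed.

Lemma cderiv_minus (f g : C -> C) (z a b : C) : cderiv f z a -> cderiv g z b ->
  cderiv (fun w => f w - g w)%C z (a - b)%C.
Proof. apply (is_derive_minus (K := C_AbsRing) (V := C_NormedModule)). Qed.

Lemma cderiv_scal (c : C) (f : C -> C) (z a : C) : cderiv f z a ->
  cderiv (fun w => c * f w)%C z (c * a)%C.
Proof.
intros H; replace (c * a)%C with (0 * f z + c * a)%C by ring.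
apply (cderiv_mult (fun _ => c)); [apply cderiv_const | exact H].
Qed.

Lemma cderiv_linear (c z : C) : cderiv (fun w => c * w)%C z c.
Proof.
assert (H := cderiv_scal c (fun w => w) z _ (cderiv_id z)).
rewrite Cmult_1_r in H; exact H.
Qed.

Lemma cderiv_pow (n : nat) (z : C) :
  cderiv (fun w => w ^ n)%C z (INR n * z ^ pred n)%C.
Proof.
induction n as [|n IH].
- replace (INR 0 * z ^ pred 0)%C with (RtoC 0) by (simpl; ring).
  apply (cderiv_const (RtoC 1)).
- replace (INR (S n) * z ^ pred (S n))%C with (1 * z ^ n + z * (INR n * z ^ pred n))%C.
  + apply (cderiv_mult (fun w => w) (fun w => w ^ n)%C); [apply cderiv_id | exact IH].
  + rewrite S_INR, RtoC_plus; destruct n as [|n]; simpl; ring.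
Qed.

(** Multiplying by [u] before taking real parts covers every real-linear functional of a
    complex value, imaginary parts included. *)
Lemma cderiv_line (f : C -> C) (u a b l : C) (t : R) :
  cderiv f (a + t * b)%C l ->
  is_derive (fun s : R => Re (u * f (a + s * b))%C) t (Re (u * (l * b))%C).
Proof.
intros H; rewrite cderiv_eps in H.
apply is_derive_Reals; intros eps Heps.
set (M := Cmod u * Cmod b + 1).
assert (HM : 0 < M).
{ pose proof (Rmult_le_pos _ _ (Cmod_ge_0 u) (Cmod_ge_0 b)); unfold M; lra. }
assert (He : 0 < eps / (2 * M)).
{ apply Rdiv_lt_0_compat; lra. }
destruct (H _ He) as [d [Hd Hw]].
set (B := Cmod b + 1).
assert (HB : 0 < B) by (pose proof (Cmod_ge_0 b); unfold B; lra).
assert (HdB : 0 < d / B) by (apply Rdiv_lt_0_compat; lra).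
(* Real steps [h] move the argument by [h * b], of modulus less than [d]. *)
exists (mkposreal _ HdB); intros h Hh0 Hh; change (Rabs h < d / B) in Hh.
assert (E : ((a + (t + h)%R * b) - (a + t * b) = h * b)%C) by (rewrite RtoC_plus; ring).
specialize (Hw (a + (t + h)%R * b)%C).
rewrite E, Cmod_mult, Cmod_R in Hw.
pose proof (Rabs_pos_lt h Hh0) as Hha.
assert (Hlt : Rabs h * Cmod b < d).
{ assert (Rabs h * B < d).
  { replace d with (d / B * B) by (field; lra). apply Rmult_lt_compat_r; auto. }
  unfold B in *; nra. }
specialize (Hw Hlt).
replace ((Re (u * f (a + (t + h)%R * b)%C)%C - Re (u * f (a + t * b)%C)%C) / h
   - Re (u * (l * b))%C)
  with (Re (u * (f (a + (t + h)%R * b)%C - f (a + t * b)%C - h * b * l))%C / h).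
2:{ unfold Re, Cmult, Cminus, Cplus, Copp, RtoC; simpl; field; auto. }
unfold Rdiv; rewrite Rabs_mult, Rabs_inv.
apply (Rmult_lt_reg_r (Rabs h)); auto.
rewrite Rmult_assoc, Rinv_l, Rmult_1_r by lra.
eapply Rle_lt_trans; [apply re_le_Cmod|].
rewrite Cmod_mult.
apply Rle_lt_trans with (Cmod u * (eps / (2 * M) * (Rabs h * Cmod b))).
{ apply Rmult_le_compat_l; [apply Cmod_ge_0 | exact Hw]. }
replace (Cmod u * (eps / (2 * M) * (Rabs h * Cmod b)))
  with ((Cmod u * Cmod b) / M * (eps / 2 * Rabs h)) by (field; lra).
assert (Hq : Cmod u * Cmod b / M <= 1).
{ apply (Rmult_le_reg_r M); auto; unfold Rdiv; rewrite Rmult_assoc, Rinv_l by lra.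
  unfold M; lra. }
assert (0 < eps / 2 * Rabs h) by nra. nra.
Qed.

Lemma derive_nonneg_le (f df : R -> R) (a b : R) : a <= b ->
  (forall t, a <= t <= b -> is_derive f t (df t)) ->
  (forall t, a <= t <= b -> 0 <= df t) -> f a <= f b.
Proof.
intros Hab Hd Hp.
destruct (MVT_gen f a b df) as [c [Hc E]].
- rewrite Rmin_left, Rmax_right by lra; intros x Hx; apply Hd; lra.
- rewrite Rmin_left, Rmax_right by lra; intros x Hx.
  apply continuity_pt_filterlim, (ex_derive_continuous (K := R_AbsRing) f).
  exists (df x); auto.
- rewrite Rmin_left, Rmax_right in Hc by lra.
  specialize (Hp c Hc); nra.
Qed.

Lemma unimodular_rotate (z : C) :
  exists u, Cmod u = 1 /\ (u * z)%C = RtoC (Cmod z).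
Proof.
destruct (Req_dec (Cmod z) 0) as [H0 | H0].
- exists (RtoC 1); split; [apply Cmod_1|].
  rewrite (Cmod_eq_0 z H0), Cmod_0; ring.
- assert (Hz : z <> RtoC 0) by (intros ->; apply H0, Cmod_0).
  assert (Hm : RtoC (Cmod z) <> RtoC 0) by (intros E; apply H0, RtoC_inj, E).
  exists (Cmod z / z)%C; split.
  + rewrite Cmod_div, Cmod_R, Rabs_pos_eq by (auto; apply Cmod_ge_0).
    field; auto.
  + field; auto.
Qed.

(** The mean value inequality for complex functions: after multiplication by a
    unimodular constant the increment is a real number, and the real mean value theorem
    applies to the real part along the segment. *)
Lemma segment_growth (h h' : C -> C) (a b : C) (B B' : R -> R) :
  (forall t, 0 <= t <= 1 -> cderiv h (a + t * (b - a))%C (h' (a + t * (b - a)))%C) ->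
  (forall t, 0 <= t <= 1 -> is_derive B t (B' t)) ->
  (forall t, 0 <= t <= 1 -> Cmod (h' (a + t * (b - a)))%C * Cmod (b - a)%C <= B' t) ->
  Cmod (h b - h a)%C <= B 1 - B 0.
Proof.
intros Hh HB Hle.
destruct (unimodular_rotate (h b - h a)%C) as [u [Hu E]].
assert (H := derive_nonneg_le (fun t => B t - Re (u * h (a + t * (b - a)))%C)
  (fun t => B' t - Re (u * (h' (a + t * (b - a)) * (b - a)))%C) 0 1 Rle_0_1).
cbv beta in H.
replace (a + 0%R * (b - a))%C with a in H by ring.
replace (a + 1%R * (b - a))%C with b in H by ring.
replace (Cmod (h b - h a)%C) with (Re (u * h b)%C - Re (u * h a)%C).
2:{ transitivity (Re (u * (h b - h a))%C); [|rewrite E; reflexivity].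
    unfold Re, Cmult, Cminus, Cplus, Copp; simpl; ring. }
enough (B 0 - Re (u * h a)%C <= B 1 - Re (u * h b)%C) by lra.
apply H.
- intros t Ht.
  apply (is_derive_minus (K := R_AbsRing) (V := R_NormedModule) B).
  + auto.
  + apply (cderiv_line h u a (b - a)%C); auto.
- intros t Ht; specialize (Hle t Ht).
  pose proof (re_le_Cmod (u * (h' (a + t * (b - a)) * (b - a)))%C) as Hr.
  rewrite !Cmod_mult, Hu in Hr.
  pose proof (Rle_abs (Re (u * (h' (a + t * (b - a)) * (b - a)))%C)); lra.
Qed.

(** * Sharp growth of Bloch functions *)

Notation beta f := (real (bloch_seminorm f)).

(** The hyperbolic distance from 0 to a point of modulus [r]. *)
Definition rho (r : R) : R := (ln (1 + r) - ln (1 - r)) / 2.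

Lemma rho_0 : rho 0 = 0.
Proof. unfold rho; rewrite Rplus_0_r, Rminus_0_r, ln_1; lra. Qed.

Lemma is_derive_rho (r : R) : -1 < r < 1 -> is_derive rho r (/ (1 - r ^ 2)).
Proof.
intros Hr; unfold rho; auto_derive; [lra|].
field; split; [|split]; nra.
Qed.

Lemma rho_lt (r s : R) : 0 <= r < s -> s < 1 -> rho r < rho s.
Proof.
intros Hr Hs; unfold rho.
assert (ln (1 + r) < ln (1 + s)) by (apply ln_increasing; lra).
assert (ln (1 - s) < ln (1 - r)) by (apply ln_increasing; lra).
lra.
Qed.

Lemma rho_ge_0 (r : R) : 0 <= r < 1 -> 0 <= rho r.
Proof.
intros [[H|<-] H1]; [|rewrite rho_0; lra].
left; rewrite <- rho_0; apply rho_lt; lra.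
Qed.

Lemma rho_le_reg (r s : R) : 0 <= r < 1 -> 0 <= s < 1 -> rho r <= rho s -> r <= s.
Proof.
intros Hr Hs H; apply Rnot_lt_le; intros Hlt.
pose proof (rho_lt s r); lra.
Qed.

(** The witness is the hyperbolic tangent of [M], so that its [rho] is exactly [M]. *)
Lemma rho_unbounded (M : R) : 0 < M ->
  exists r, 0 < r < 1 /\ forall s, r <= s < 1 -> M <= rho s.
Proof.
intros HM; set (E := exp (2 * M)).
assert (HE : 1 < E) by (unfold E; rewrite <- exp_0; apply exp_increasing; lra).
assert (Hr : 0 < (E - 1) / (E + 1) < 1).
{ split; [apply Rdiv_lt_0_compat; lra|].
  apply (Rmult_lt_reg_r (E + 1)); [lra|].
  unfold Rdiv; rewrite Rmult_assoc, Rinv_l; lra. }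
assert (HMr : rho ((E - 1) / (E + 1)) = M).
{ unfold rho.
  rewrite <- ln_div by lra.
  replace ((1 + (E - 1) / (E + 1)) / (1 - (E - 1) / (E + 1))) with E by (field; lra).
  unfold E; rewrite ln_exp; lra. }
exists ((E - 1) / (E + 1)); split; auto.
intros s [[Hs | <-] Hs1]; [|lra].
pose proof (rho_lt ((E - 1) / (E + 1)) s); lra.
Qed.

Lemma disk_Cmod (z : C) : disk z -> 0 <= Cmod z < 1.
Proof. unfold disk; intros; split; auto; apply Cmod_ge_0. Qed.

(** Integrate [|f'(w)| <= beta f / (1 - |w|^2)] along the radius to [z]. *)
Lemma bloch_growth (f : C -> C) (z : C) : in_bloch f -> disk z ->
  Cmod (f z - f (RtoC 0))%C <= beta f * rho (Cmod z).
Proof.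
intros Hf Hz; pose proof (disk_Cmod z Hz) as Hm.
assert (Hd : forall t, 0 <= t <= 1 ->
  disk (t * z)%C /\ Cmod (t * z)%C = t * Cmod z).
{ intros t Ht; unfold disk; rewrite Cmod_mult, Cmod_R, Rabs_pos_eq by lra; nra. }
assert (E : forall t : R, (RtoC 0 + t * (z - RtoC 0))%C = (t * z)%C) by (intros; ring).
assert (H := segment_growth f (C_derive f) (RtoC 0) z
  (fun t => beta f * rho (t * Cmod z))
  (fun t => beta f * (Cmod z * / (1 - (t * Cmod z) ^ 2)))).
cbv beta in H; rewrite Rmult_0_l, rho_0, Rmult_1_l in H.
rewrite Rmult_0_r, Rminus_0_r in H; apply H; intros t Ht; rewrite ?E;
  destruct (Hd t Ht) as [Hd1 Hd2].
- apply analytic_derive; auto; apply Hf.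
- apply (is_derive_scal (fun t => rho (t * Cmod z))).
  apply (is_derive_comp (K := R_AbsRing) (V := R_NormedModule) rho).
  + apply is_derive_rho; nra.
  + auto_derive; auto; ring.
- pose proof (seminorm_ge f _ Hf Hd1) as Hs.
  pose proof (disk_weight _ Hd1) as Hw; rewrite Hd2 in Hs, Hw.
  replace (z - RtoC 0)%C with z by ring.
  apply (Rmult_le_reg_l (1 - (t * Cmod z) ^ 2)); auto.
  replace ((1 - (t * Cmod z) ^ 2) * (beta f * (Cmod z * / (1 - (t * Cmod z) ^ 2))))
    with (beta f * Cmod z) by (field; lra).
  rewrite <- Rmult_assoc; apply Rmult_le_compat_r; lra.
Qed.

(** The derivative of [atanh_sum], a geometric sum of ratio [z^2]. *)
Fixpoint geom2 (n : nat) (z : C) : C :=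
  match n with O => RtoC 0 | S m => (geom2 m z + z ^ (2 * m))%C end.

(** Partial sums of the series of the inverse hyperbolic tangent. *)
Fixpoint atanh_sum (n : nat) (z : C) : C :=
  match n with
  | O => RtoC 0
  | S m => (atanh_sum m z + RtoC (/ INR (S (2 * m))) * z ^ S (2 * m))%C
  end.

Lemma cderiv_atanh_sum (n : nat) (z : C) : cderiv (atanh_sum n) z (geom2 n z).
Proof.
induction n as [|n IH].
- apply (cderiv_const (RtoC 0)).
- apply (cderiv_plus (atanh_sum n)); auto.
  replace (z ^ (2 * n))%C
    with (RtoC (/ INR (S (2 * n))) * (INR (S (2 * n)) * z ^ pred (S (2 * n))))%C.
  + apply (cderiv_scal _ (fun w => w ^ S (2 * n))%C), cderiv_pow.
  + rewrite Cmult_assoc, <- RtoC_mult, Rinv_l by (apply not_0_INR; lia).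
    rewrite Cmult_1_l; reflexivity.
Qed.

Lemma atanh_sum_0 (n : nat) : atanh_sum n (RtoC 0) = RtoC 0.
Proof.
induction n as [|n IH]; auto; cbn [atanh_sum]; rewrite IH; simpl Cpow; ring.
Qed.

Lemma geom2_eq (n : nat) (z : C) : ((1 - z ^ 2) * geom2 n z = 1 - z ^ (2 * n))%C.
Proof.
induction n as [|n IH].
- simpl; ring.
- replace (2 * S n)%nat with (2 + 2 * n)%nat by lia.
  rewrite Cpow_add_r; cbn [geom2]; rewrite Cmult_plus_distr_l, IH; ring.
Qed.

Lemma geom2_bound (n : nat) (z : C) : disk z -> (1 - Cmod z ^ 2) * Cmod (geom2 n z) <= 1.
Proof.
intros Hz; pose proof (disk_weight z Hz) as Hw.
enough (H : (1 - Cmod z ^ 2) * Cmod (geom2 n z) <= 1 - Cmod z ^ (2 * n)).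
{ pose proof (pow_le _ (2 * n) (Cmod_ge_0 z)); lra. }
induction n as [|n IH].
- simpl; rewrite Cmod_0; lra.
- replace (2 * S n)%nat with (2 + 2 * n)%nat by lia.
  rewrite pow_add; cbn [geom2].
  pose proof (Cmod_triangle (geom2 n z) (z ^ (2 * n))%C) as Ht.
  rewrite Cmod_pow in Ht.
  apply Rle_trans with ((1 - Cmod z ^ 2) * (Cmod (geom2 n z) + Cmod z ^ (2 * n))).
  { apply Rmult_le_compat_l; lra. }
  lra.
Qed.

(** On a radius the derivative of the partial sum is [(1 - x^(2n)) / (1 - x^2)], which is
    at least [1 - r^(2n)] times the derivative of [rho] for [x <= r]. *)
Lemma atanh_sum_lower (n : nat) (r : R) : 0 <= r < 1 ->
  (1 - r ^ (2 * n)) * rho r <= Cmod (atanh_sum n (RtoC r)).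
Proof.
intros Hr.
assert (H := derive_nonneg_le
  (fun t => Re (1 * atanh_sum n (0 + t * r))%C - (1 - r ^ (2 * n)) * rho (t * r))
  (fun t => Re (1 * (geom2 n (0 + t * r) * r))%C
            - (1 - r ^ (2 * n)) * (r * / (1 - (t * r) ^ 2))) 0 1 Rle_0_1).
cbv beta in H.
rewrite Rmult_0_l, rho_0, Rmult_1_l, Rmult_0_r in H.
replace (0 + 0%R * r)%C with (RtoC 0) in H by ring.
replace (0 + 1%R * r)%C with (RtoC r) in H by ring.
rewrite atanh_sum_0 in H.
replace (Re (1 * 0)%C) with 0 in H by (simpl; ring).
rewrite Cmult_1_l in H.
enough (0 - 0 <= Re (atanh_sum n r) - (1 - r ^ (2 * n)) * rho r).
{ pose proof (re_le_Cmod (atanh_sum n r)).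
  pose proof (Rle_abs (Re (atanh_sum n r))); lra. }
apply H; intros t Ht.
- apply (is_derive_minus (K := R_AbsRing) (V := R_NormedModule)
           (fun s => Re (1 * atanh_sum n (0 + s * r))%C)).
  + apply cderiv_line, cderiv_atanh_sum.
  + apply (is_derive_scal (fun t => rho (t * r))).
    apply (is_derive_comp (K := R_AbsRing) (V := R_NormedModule) rho).
    * apply is_derive_rho; nra.
    * auto_derive; auto; ring.
- replace (0 + t * r)%C with (RtoC (t * r)) by (rewrite RtoC_mult; ring).
  set (x := t * r); assert (Hx : 0 <= x <= r) by (unfold x; nra).
  assert (Hx2 : 0 < 1 - x ^ 2) by nra.
  assert (E : geom2 n (RtoC x) = RtoC ((1 - x ^ (2 * n)) / (1 - x ^ 2))).
  { assert (Hn : RtoC (1 - x ^ 2) <> RtoC 0) by (intros E; apply RtoC_inj in E; lra).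
    assert (E2 := geom2_eq n (RtoC x)).
    rewrite <- !RtoC_pow, <- !RtoC_minus in E2.
    unfold Rdiv; rewrite RtoC_mult, <- E2, RtoC_inv by lra.
    field; auto. }
  rewrite E, Cmult_1_l, <- RtoC_mult, re_RtoC.
  pose proof (pow_incr x r (2 * n) Hx) as Hp.
  replace ((1 - x ^ (2 * n)) / (1 - x ^ 2) * r - (1 - r ^ (2 * n)) * (r * / (1 - x ^ 2)))
    with ((r ^ (2 * n) - x ^ (2 * n)) * r * / (1 - x ^ 2)) by (field; lra).
  pose proof (Rinv_0_lt_compat _ Hx2); apply Rmult_le_pos; [apply Rmult_le_pos|]; lra.
Qed.

(** Sharpness of [bloch_growth].  The extremal function is the inverse hyperbolic
    tangent, rotated; its partial sums suffice and are polynomials. *)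
Lemma bloch_growth_sharp (z : C) (c : R) : disk z -> c < rho (Cmod z) ->
  exists f, in_bloch f /\ f (RtoC 0) = RtoC 0 /\ beta f <= 1 /\ c < Cmod (f z).
Proof.
intros Hz Hc; pose proof (disk_Cmod z Hz) as Hm.
pose proof (rho_ge_0 _ Hm) as Hrho.
destruct (unimodular_rotate z) as [u [Hu Huz]].
(* [y] is small enough that [(1 - y) * rho |z| > c]; the denominator avoids [rho 0 = 0]. *)
set (y := (rho (Cmod z) - c) / (rho (Cmod z) + 1)).
assert (Hy : 0 < y) by (apply Rdiv_lt_0_compat; lra).
assert (Hyr : y * rho (Cmod z) < rho (Cmod z) - c).
{ replace (rho (Cmod z) - c) with (y * (rho (Cmod z) + 1)) by (unfold y; field; lra). lra. }
destruct (pow_lt_1_zero (Cmod z)) with (y := y) as [n Hn]; auto.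
{ rewrite Rabs_pos_eq; lra. }
specialize (Hn (2 * n)%nat); rewrite Rabs_pos_eq in Hn by (apply pow_le; lra).
destruct (in_bloch_of_derive (fun w => atanh_sum n (u * w)%C)
  (fun w => u * geom2 n (u * w))%C 1) as [H1 H2].
- intros w _.
  apply (cderiv_comp (atanh_sum n) (fun w => u * w)%C); [apply cderiv_atanh_sum|].
  apply cderiv_linear.
- intros w Hw; rewrite Cmod_mult, Hu, Rmult_1_l.
  replace (Cmod w) with (Cmod (u * w)%C) by (rewrite Cmod_mult, Hu; ring).
  apply geom2_bound; unfold disk; rewrite Cmod_mult, Hu, Rmult_1_l; exact Hw.
- exists (fun w => atanh_sum n (u * w)%C); split; [exact H1|]; split; [|split]; auto.
  + rewrite Cmult_0_r; apply atanh_sum_0.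
  + rewrite Huz; pose proof (atanh_sum_lower n _ Hm) as Hl.
    assert (Cmod z ^ (2 * n) < y) by (apply Hn; lia). nra.
Qed.

(** * Isometric multiplication operators *)

Lemma beta_const (c : C) : in_bloch (fun _ => c) /\ beta (fun _ => c) = 0.
Proof.
destruct (in_bloch_of_derive (fun _ => c) (fun _ => RtoC 0) 0) as [H1 H2].
- intros; apply cderiv_const.
- intros; rewrite Cmod_0; lra.
- split; auto; apply Rle_antisym; auto; apply seminorm_ge_0; auto.
Qed.

Lemma beta_plus_const (f : C -> C) (c : C) : in_bloch f ->
  in_bloch (fun z => f z + c)%C /\ beta (fun z => f z + c)%C <= beta f.
Proof.
intros Hf; apply (in_bloch_of_derive _ (C_derive f)).
- intros z Hz; rewrite <- (Cplus_0_r (C_derive f z)).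
  apply (cderiv_plus f); [apply analytic_derive; auto; apply Hf | apply cderiv_const].
- intros; apply seminorm_ge; auto.
Qed.

Lemma beta_plus_const_eq (f : C -> C) (c : C) : in_bloch f ->
  beta (fun z => f z + c)%C = beta f.
Proof.
intros Hf; destruct (beta_plus_const f c Hf) as [Hg Hle].
apply Rle_antisym; auto.
destruct (beta_plus_const _ (- c)%C Hg) as [_ H].
replace (fun z => (f z + c + - c)%C) with f in H; auto.
apply functional_extensionality; intros z; ring.
Qed.

Lemma in_bloch_pow (k : nat) : in_bloch (fun z => z ^ k)%C.
Proof.
apply (in_bloch_of_derive _ (fun z => INR k * z ^ pred k)%C (INR k)).
- intros; apply cderiv_pow.
- intros z Hz; pose proof (disk_weight z Hz) as Hw; pose proof (disk_Cmod z Hz) as Hm.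
  rewrite Cmod_mult, Cmod_R, Cmod_pow, Rabs_pos_eq by apply pos_INR.
  pose proof (pos_INR k) as Hk.
  assert (Hp : 0 <= Cmod z ^ pred k <= 1).
  { split; [apply pow_le; lra|].
    rewrite <- (pow1 (pred k)); apply pow_incr; lra. }
  assert (0 <= (INR k * Cmod z ^ pred k) <= INR k) by nra. nra.
Qed.

Lemma bloch_norm_vanish (f : C -> C) : f (RtoC 0) = RtoC 0 -> bloch_norm f = beta f.
Proof. intros H; unfold bloch_norm; rewrite H, Cmod_0; ring. Qed.

Lemma Cpow_0_l (k : nat) : (0 ^ S k = 0)%C.
Proof. rewrite Cpow_S; ring. Qed.

Lemma bloch_seminorm_0_const (f : C -> C) (z : C) : in_bloch f -> beta f <= 0 -> disk z ->
  f z = f (RtoC 0).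
Proof.
intros Hf Hb Hz.
pose proof (bloch_growth f z Hf Hz) as H.
pose proof (rho_ge_0 _ (disk_Cmod z Hz)); pose proof (Cmod_ge_0 (f z - f (RtoC 0))%C).
assert (E : (f z - f (RtoC 0))%C = RtoC 0) by (apply Cmod_eq_0; nra).
replace (f z) with (f z - f (RtoC 0) + f (RtoC 0))%C by ring.
rewrite E; ring.
Qed.

Lemma mul_op_derive (psi f : C -> C) (z : C) : in_bloch psi -> in_bloch f ->
  in_bloch (mul_op psi f) -> disk z ->
  (1 - Cmod z ^ 2) * Cmod (C_derive psi z * f z + psi z * C_derive f z)%C
    <= beta (mul_op psi f).
Proof.
intros Hp Hf Hm Hz.
rewrite <- (is_C_derive_unique (mul_op psi f) z
  (C_derive psi z * f z + psi z * C_derive f z)%C).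
- apply seminorm_ge; auto.
- apply (cderiv_mult psi f); apply analytic_derive; auto; [apply Hp | apply Hf].
Qed.

Lemma C_derive_pow (k : nat) (z : C) :
  C_derive (fun w => w ^ k)%C z = (INR k * z ^ pred k)%C.
Proof. apply is_C_derive_unique, cderiv_pow. Qed.

(** Apply the operator to the constant 1. *)
Lemma isometric_mul_in_bloch (psi : C -> C) : isometric_on_bloch (mul_op psi) ->
  in_bloch psi /\ Cmod (psi (RtoC 0)) + beta psi = 1.
Proof.
intros [Hm Hn].
destruct (beta_const (RtoC 1)) as [H1 H2].
assert (E : mul_op psi (fun _ => RtoC 1) = psi).
{ apply functional_extensionality; intros; apply Cmult_1_r. }
specialize (Hm _ H1); specialize (Hn _ H1); rewrite E in Hm, Hn; split; auto.
unfold bloch_norm in Hn; rewrite H2, Cmod_1 in Hn; lra.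
Qed.

(** All powers of the symbol have norm 1 and point evaluations are bounded, so the powers
    of [|psi z|] form a bounded sequence. *)
Lemma isometric_mul_bounded (psi : C -> C) (z : C) :
  isometric_on_bloch (mul_op psi) -> disk z -> Cmod (psi z) <= 1.
Proof.
intros [Hm Hn] Hz.
assert (Hpow : forall n, in_bloch (fun w => psi w ^ n)%C /\
                         bloch_norm (fun w => psi w ^ n)%C = 1).
{ induction n as [|n [IH1 IH2]].
  - destruct (beta_const (RtoC 1)) as [H1 H2]; split; [exact H1|].
    unfold bloch_norm; simpl Cpow; rewrite H2, Cmod_1; ring.
  - change (fun w => psi w ^ S n)%C with (mul_op psi (fun w => psi w ^ n)%C).
    split; auto; rewrite Hn; auto. }
pose proof (rho_ge_0 _ (disk_Cmod z Hz)) as Hr.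
assert (Hb : forall n, Cmod (psi z) ^ n <= 1 + rho (Cmod z)).
{ intros n; destruct (Hpow n) as [H1 H2]; unfold bloch_norm in H2.
  pose proof (bloch_growth _ z H1 Hz) as H.
  pose proof (Cmod_ge_0 (psi (RtoC 0) ^ n)%C).
  pose proof (seminorm_ge_0 _ H1).
  rewrite <- Cmod_pow.
  replace (psi z ^ n)%C with (psi z ^ n - psi (RtoC 0) ^ n + psi (RtoC 0) ^ n)%C by ring.
  eapply Rle_trans; [apply Cmod_triangle|]. nra. }
apply Rnot_lt_le; intros Hlt.
destruct (Pow_x_infinity (Cmod (psi z))) with (b := 2 + rho (Cmod z)) as [N HN].
{ rewrite Rabs_pos_eq; lra. }
specialize (HN N (le_n N)); specialize (Hb N).
rewrite Rabs_pos_eq in HN; [lra | apply pow_le; lra].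
Qed.

(** Multiply the extremal functions of [bloch_growth_sharp]: they are large at [z] while
    their own derivative is controlled, so the derivative of the symbol must be small.
    Thus the symbol lies in the little Bloch space. *)
Lemma isometric_mul_derive_small (psi : C -> C) (z : C) :
  isometric_on_bloch (mul_op psi) -> disk z ->
  (1 - Cmod z ^ 2) * Cmod (C_derive psi z) * rho (Cmod z) <= 4.
Proof.
intros Hiso Hz.
pose proof (isometric_mul_bounded psi z Hiso Hz) as Hpz.
destruct (isometric_mul_in_bloch psi Hiso) as [Hp _].
pose proof (disk_weight z Hz) as Hw.
pose proof (Cmod_ge_0 (C_derive psi z)) as Hd.
destruct (rho_ge_0 _ (disk_Cmod z Hz)) as [Hr | <-]; [|lra].
destruct (bloch_growth_sharp z (rho (Cmod z) / 2) Hz) as [f [Hf [Hf0 [Hfb Hfz]]]]; [lra|].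
assert (Hmf : in_bloch (mul_op psi f)) by (apply Hiso; auto).
assert (Hb : beta (mul_op psi f) <= 1).
{ rewrite <- bloch_norm_vanish by (unfold mul_op; rewrite Hf0; ring).
  destruct Hiso as [_ ->]; auto; rewrite bloch_norm_vanish; auto. }
pose proof (mul_op_derive psi f z Hp Hf Hmf Hz) as H1.
pose proof (seminorm_ge f z Hf Hz) as H2.
assert (H3 : Cmod (C_derive psi z * f z)%C <=
  Cmod (C_derive psi z * f z + psi z * C_derive f z)%C + Cmod (psi z * C_derive f z)%C).
{ replace (C_derive psi z * f z)%C with
    ((C_derive psi z * f z + psi z * C_derive f z) + - (psi z * C_derive f z))%C at 1 by ring.
  eapply Rle_trans; [apply Cmod_triangle|]; rewrite Cmod_opp; lra. }
rewrite !Cmod_mult in H3.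
pose proof (Cmod_ge_0 (C_derive f z)) as Hdf; pose proof (Cmod_ge_0 (psi z)) as Hp0.
assert (H4 : Cmod (psi z) * Cmod (C_derive f z) <= Cmod (C_derive f z)) by nra.
assert (H5 : (1 - Cmod z ^ 2) * (Cmod (C_derive psi z) * Cmod (f z)) <= 2).
{ apply Rle_trans with ((1 - Cmod z ^ 2) *
    (Cmod (C_derive psi z * f z + psi z * C_derive f z)%C + Cmod (C_derive f z))).
  - apply Rmult_le_compat_l; lra.
  - lra. }
assert (H6 : Cmod (C_derive psi z) * (rho (Cmod z) / 2) <= Cmod (C_derive psi z) * Cmod (f z))
  by (apply Rmult_le_compat_l; lra).
assert (H7 : (1 - Cmod z ^ 2) * (Cmod (C_derive psi z) * (rho (Cmod z) / 2)) <=
  (1 - Cmod z ^ 2) * (Cmod (C_derive psi z) * Cmod (f z)))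
  by (apply Rmult_le_compat_l; lra).
lra.
Qed.

(** Test the isometry on [z^k + 1].  If [d = 1 - |psi 0| = beta psi] were positive, the
    image would have seminorm [d + beta z^k]; but away from the boundary [z^k] contributes
    almost nothing, and near the boundary the derivative of [psi] contributes at most
    [d / 2]. *)
Lemma isometric_mul_const (psi : C -> C) : isometric_on_bloch (mul_op psi) ->
  exists eta, Cmod eta = 1 /\ forall z, disk z -> psi z = eta.
Proof.
intros Hiso; pose proof Hiso as [Hmaps Hnorm].
destruct (isometric_mul_in_bloch psi Hiso) as [Hp Hp1].
pose proof (seminorm_ge_0 psi Hp) as Hb0.
destruct (Rle_lt_dec (beta psi) 0) as [Hle | Hd].
{ exists (psi (RtoC 0)); split; [lra|].
  intros z Hz; apply bloch_seminorm_0_const; auto. }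
exfalso; set (d := beta psi) in *.
destruct (rho_unbounded (8 / d)) as [s [Hs HsM]]; [apply Rdiv_lt_0_compat; lra|].
(* With [r > s], the ratio of [s^m] to [r^m] tends to 0: on [|z| <= s] the derivative of
   [z^k] becomes negligible against its value at [r]. *)
set (r := (1 + s) / 2).
assert (Hr : s < r < 1) by (unfold r; lra).
destruct (pow_lt_1_zero (s / r)) with (y := (1 - r ^ 2) / 2) as [m Hm].
{ rewrite Rabs_pos_eq.
  - apply (Rmult_lt_reg_r r); [lra|]; unfold Rdiv; rewrite Rmult_assoc, Rinv_l; lra.
  - left; apply Rdiv_lt_0_compat; lra. }
{ nra. }
specialize (Hm m (le_n m)).
rewrite Rabs_pos_eq in Hm by (apply pow_le; left; apply Rdiv_lt_0_compat; lra).
assert (Hrm : 0 < r ^ m) by (apply pow_lt; lra).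
assert (Hsm : 2 * s ^ m < r ^ m * (1 - r ^ 2)).
{ replace (s ^ m) with ((s / r) ^ m * r ^ m).
  - nra.
  - rewrite <- Rpow_mult_distr; f_equal; field; lra. }
set (k := S m); set (p := fun z : C => (z ^ k)%C).
assert (Hpk : in_bloch p) by apply in_bloch_pow.
assert (Hk : 1 <= INR k) by (change 1 with (INR 1); apply le_INR; unfold k; lia).
assert (Hpk0 : p (RtoC 0) = RtoC 0) by apply Cpow_0_l.
assert (Hlow : INR k * (r ^ m * (1 - r ^ 2)) <= beta p).
{ assert (Hrd : disk (RtoC r)) by (unfold disk; rewrite Cmod_R, Rabs_pos_eq; lra).
  pose proof (seminorm_ge p _ Hpk Hrd) as H.
  unfold p in H at 1; rewrite C_derive_pow, Cmod_mult, Cmod_pow, !Cmod_R in H.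
  rewrite !Rabs_pos_eq in H by (apply pos_INR || lra).
  simpl pred in H; lra. }
destruct (beta_plus_const p (RtoC 1) Hpk) as [Hq _].
set (q := fun z => (p z + RtoC 1)%C) in *.
assert (Hqb' : beta q = beta p) by (apply beta_plus_const_eq; auto).
assert (Hmp : in_bloch (mul_op psi p)) by (apply Hmaps; auto).
assert (Hmpb : beta (mul_op psi p) = beta p).
{ rewrite <- !bloch_norm_vanish; auto; unfold mul_op; rewrite Hpk0; ring. }
assert (Hmqb : beta (mul_op psi q) = d + beta p).
{ assert (Hq0 : q (RtoC 0) = RtoC 1) by (unfold q; rewrite Hpk0; ring).
  pose proof (Hnorm q Hq) as H; unfold bloch_norm in H.
  change (mul_op psi q (RtoC 0)) with (psi (RtoC 0) * q (RtoC 0))%C in H.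
  rewrite Hq0, Cmult_1_r, Cmod_1, Hqb' in H; lra. }
assert (Hup : beta (mul_op psi q) <= Rmax (d / 2 + beta p) (d + 2 * INR k * s ^ m)).
{ apply (in_bloch_of_derive _ (fun z => (C_derive psi z * p z + psi z * C_derive p z)
    + C_derive psi z)%C).
  - intros z Hz.
    replace (C_derive psi z * p z + psi z * C_derive p z + C_derive psi z)%C
      with (C_derive psi z * q z + psi z * (C_derive p z + 0))%C by (unfold q; ring).
    apply (cderiv_mult psi q); [apply analytic_derive; auto; apply Hp|].
    apply (cderiv_plus p); [apply analytic_derive; auto; apply Hpk | apply cderiv_const].
  - intros z Hz.
    pose proof (disk_weight z Hz) as Hw; pose proof (disk_Cmod z Hz) as Hz1.
    pose proof (seminorm_ge psi z Hp Hz) as Hdz; fold d in Hdz.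
    pose proof (Cmod_triangle (C_derive psi z * p z + psi z * C_derive p z)%C
                              (C_derive psi z)) as Ht.
    apply Rle_trans with ((1 - Cmod z ^ 2) *
      Cmod (C_derive psi z * p z + psi z * C_derive p z)%C
      + (1 - Cmod z ^ 2) * Cmod (C_derive psi z)).
    { rewrite <- Rmult_plus_distr_l; apply Rmult_le_compat_l; lra. }
    destruct (Rle_lt_dec s (Cmod z)) as [Hsz | Hsz].
    + eapply Rle_trans; [|apply Rmax_l].
      pose proof (mul_op_derive psi p z Hp Hpk Hmp Hz) as H1; rewrite Hmpb in H1.
      pose proof (isometric_mul_derive_small psi z Hiso Hz) as H2.
      assert (HsM' : 8 / d <= rho (Cmod z)) by (apply HsM; lra).
      assert ((1 - Cmod z ^ 2) * Cmod (C_derive psi z) <= d / 2); [|lra].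
      set (x := (1 - Cmod z ^ 2) * Cmod (C_derive psi z)) in *.
      assert (Hx : 0 <= x) by (apply Rmult_le_pos; [lra | apply Cmod_ge_0]).
      assert (x * (8 / d) <= 4) by nra.
      replace x with (x * (8 / d) * (d / 8)) by (field; lra).
      replace (d / 2) with (4 * (d / 8)) by field.
      apply Rmult_le_compat_r; lra.
    + eapply Rle_trans; [|apply Rmax_r].
      pose proof (isometric_mul_bounded psi z Hiso Hz) as Hpz.
      pose proof (Cmod_triangle (C_derive psi z * p z)%C (psi z * C_derive p z)%C) as Ht2.
      assert (Epz : Cmod (p z) = Cmod z * Cmod z ^ m) by apply Cmod_pow.
      assert (Edz : Cmod (C_derive p z) = INR k * Cmod z ^ m).
      { unfold p; rewrite C_derive_pow, Cmod_mult, Cmod_R, Cmod_pow, Rabs_pos_eq; auto.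
        apply pos_INR. }
      rewrite !Cmod_mult, Epz, Edz in Ht2.
      pose proof (pow_incr (Cmod z) s m) as Hi.
      pose proof (pow_le (Cmod z) m) as Hi0.
      pose proof (Cmod_ge_0 (C_derive psi z)) as Hc0; pose proof (Cmod_ge_0 (psi z)) as Hc1.
      set (y := Cmod z ^ m) in *; set (w := 1 - Cmod z ^ 2) in *.
      assert (Hy : 0 <= y <= s ^ m) by (split; [apply Hi0 | apply Hi]; lra).
      assert (Hw1 : w <= 1) by (unfold w; nra).
      assert (A1 : w * (Cmod (C_derive psi z) * (Cmod z * y)) <= s ^ m).
      { replace (w * (Cmod (C_derive psi z) * (Cmod z * y)))
          with (w * Cmod (C_derive psi z) * (Cmod z * y)) by ring.
        assert (d <= 1) by (pose proof (Cmod_ge_0 (psi (RtoC 0))); lra).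
        assert (0 <= Cmod z * y <= y) by nra.
        assert (0 <= w * Cmod (C_derive psi z)) by nra. nra. }
      assert (A2 : w * (Cmod (psi z) * (INR k * y)) <= INR k * s ^ m).
      { assert (0 <= INR k * y <= INR k * s ^ m) by nra.
        assert (0 <= Cmod (psi z) * (INR k * y) <= INR k * y) by nra. nra. }
      assert (A3 : s ^ m <= INR k * s ^ m) by nra.
      assert (A4 : w * Cmod (C_derive psi z * p z + psi z * C_derive p z)%C <=
        w * (Cmod (C_derive psi z) * (Cmod z * y) + Cmod (psi z) * (INR k * y)))
        by (apply Rmult_le_compat_l; lra).
      lra. }
rewrite Hmqb in Hup.
assert (2 * INR k * s ^ m < beta p) by nra.
revert Hup; apply Rlt_not_le, Rmax_lub_lt; lra.
Qed.

(** * Isometric composition operators *)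

Lemma bloch_norm_ext (f g : C -> C) : (forall z, disk z -> f z = g z) ->
  in_bloch f -> bloch_norm g = bloch_norm f.
Proof.
intros Hfg Hf; destruct (in_bloch_ext f g Hfg Hf) as [Hg H1].
destruct (in_bloch_ext g f) as [_ H2]; auto.
- intros; symmetry; auto.
- lra.
Qed.

(** Test the isometry on [z] and on [z - phi 0]. *)
Lemma isometric_comp_0 (phi : C -> C) : isometric_on_bloch (comp_op phi) ->
  phi (RtoC 0) = RtoC 0.
Proof.
intros [Hmaps Hnorm].
assert (Hid : in_bloch (fun z => z)).
{ apply (in_bloch_ext (fun z => z ^ 1)%C); [intros; ring | apply in_bloch_pow]. }
assert (Hphi : in_bloch phi) by exact (Hmaps _ Hid).
set (c := (- phi (RtoC 0))%C).
destruct (beta_plus_const _ c Hid) as [Hidc _].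
pose proof (Hnorm _ Hid) as H1; pose proof (Hnorm _ Hidc) as H2.
unfold bloch_norm, comp_op in H1, H2.
rewrite (beta_plus_const_eq (fun z => z) c Hid) in H2.
rewrite (beta_plus_const_eq phi c Hphi) in H2.
change (beta (fun z : C => phi z)) with (beta phi) in H1.
replace (phi (RtoC 0) + c)%C with (RtoC 0) in H2 by (unfold c; ring).
rewrite Cplus_0_l in H2; unfold c in H2; rewrite Cmod_opp, Cmod_0 in H2.
rewrite Cmod_0 in H1.
apply Cmod_eq_0; lra.
Qed.

(** Both inequalities compare the sharp growth bound at [z] and at [phi z].  For
    [|phi z| <= |z|], compose an extremal function at [phi z] with [phi]; for the converse,
    write an extremal function at [z] as [h o phi] with [beta h <= 1]. *)
Lemma isometric_comp_onto_Cmod (phi : C -> C) :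
  (forall z, disk z -> disk (phi z)) ->
  isometric_on_bloch (comp_op phi) ->
  (forall g, in_bloch g -> exists h, in_bloch h /\ forall z, disk z -> h (phi z) = g z) ->
  forall z, disk z -> Cmod (phi z) = Cmod z.
Proof.
intros Hself Hiso Honto z Hz; pose proof Hiso as [Hmaps Hnorm].
pose proof (isometric_comp_0 phi Hiso) as H0.
pose proof (disk_Cmod z Hz) as Hm; pose proof (disk_Cmod _ (Hself z Hz)) as Hm'.
pose proof (rho_ge_0 _ Hm) as Hr; pose proof (rho_ge_0 _ Hm') as Hr'.
apply Rle_antisym; apply rho_le_reg; auto; apply Rnot_lt_le; intros Hlt.
- destruct (bloch_growth_sharp (phi z) _ (Hself z Hz) Hlt) as [f [Hf [Hf0 [Hfb Hfz]]]].
  pose proof (Hmaps f Hf) as Hg.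
  pose proof (bloch_growth _ z Hg Hz) as Hgr.
  assert (Hg0 : comp_op phi f (RtoC 0) = RtoC 0) by (unfold comp_op; rewrite H0; auto).
  rewrite <- (bloch_norm_vanish _ Hg0), (Hnorm f Hf), (bloch_norm_vanish f Hf0), Hg0 in Hgr.
  unfold comp_op in Hgr.
  replace (f (phi z) - 0)%C with (f (phi z)) in Hgr by ring.
  nra.
- destruct (bloch_growth_sharp z _ Hz Hlt) as [g [Hg [Hg0 [Hgb Hgz]]]].
  destruct (Honto g Hg) as [h [Hh Hhg]].
  assert (Hh0 : h (RtoC 0) = RtoC 0).
  { rewrite <- H0 at 1; rewrite Hhg; auto using disk_0. }
  assert (Hhb : beta h = beta g).
  { rewrite <- !bloch_norm_vanish, <- (Hnorm h Hh); auto; symmetry.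
    apply bloch_norm_ext; auto. }
  pose proof (bloch_growth h _ Hh (Hself z Hz)) as Hgr.
  rewrite Hhg, Hh0, Hhb in Hgr by auto.
  replace (g z - 0)%C with (g z) in Hgr by ring.
  nra.
Qed.

Lemma cderiv_line_Cmod2 (f : C -> C) (a b l : C) (t : R) :
  cderiv f (a + t * b)%C l ->
  is_derive (fun s : R => Cmod (f (a + s * b)%C) ^ 2) t
            (2 * Re (Cconj (f (a + t * b)) * (l * b))%C).
Proof.
intros H.
pose proof (cderiv_line f (RtoC 1) a b l t H) as H1.
pose proof (cderiv_line f (- Ci)%C a b l t H) as H2.
apply (is_derive_ext (K := R_AbsRing) (V := R_NormedModule)
         (fun s : R => Re (1 * f (a + s * b)%C)%C ^ 2
                             + Re (- Ci * f (a + s * b)%C)%C ^ 2)).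
{ intros s; rewrite Cmod2_alt; destruct (f (a + s * b)%C); simpl; ring. }
evar_last.
- apply (is_derive_plus (K := R_AbsRing) (V := R_NormedModule));
    apply is_derive_pow; [exact H1 | exact H2].
- unfold plus; simpl; ring.
Qed.

(** The real part of [x * Ci] is minus the imaginary part of [x]. *)
Lemma C_eq_Re (x y : C) : Re x = Re y -> Re (x * Ci)%C = Re (y * Ci)%C -> x = y.
Proof.
destruct x as [x1 x2], y as [y1 y2]; simpl; intros H1 H2.
f_equal; lra.
Qed.

(** Differentiating [|phi|^2 = |z|^2] in two directions gives [conj phi * phi' = conj z],
    and [|phi| = |z|] turns this into Euler's equation for a homogeneous function. *)
Lemma Cmod_preserving_euler (phi : C -> C) (z : C) : analytic phi ->
  (forall w, disk w -> Cmod (phi w) = Cmod w) -> disk z -> z <> RtoC 0 ->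
  (z * C_derive phi z = phi z)%C.
Proof.
intros Han Hmod Hz Hz0.
set (d := C_derive phi z).
assert (Hdir : forall b, Re (Cconj (phi z) * (d * b))%C = Re (Cconj z * (1 * b))%C).
{ intros b.
  assert (Ez : (z + 0%R * b)%C = z) by ring.
  assert (H1 := cderiv_line_Cmod2 phi z b d 0); rewrite Ez in H1.
  specialize (H1 (analytic_derive phi z Han Hz)).
  assert (H2 := cderiv_line_Cmod2 (fun w => w) z b (RtoC 1) 0 (cderiv_id _)).
  cbv beta in H2; rewrite Ez in H2.
  assert (HB : 0 < Cmod b + 1) by (pose proof (Cmod_ge_0 b); lra).
  assert (He : 0 < (1 - Cmod z) / (Cmod b + 1)).
  { unfold disk in Hz; apply Rdiv_lt_0_compat; lra. }
  apply (is_derive_ext_loc (fun s : R => Cmod (phi (z + s * b)%C) ^ 2)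
                           (fun s : R => Cmod (z + s * b)%C ^ 2)) in H1.
  - apply is_derive_unique in H1; apply is_derive_unique in H2; lra.
  - exists (mkposreal _ He); intros s Hs.
    change (Rabs (s - 0) < (1 - Cmod z) / (Cmod b + 1)) in Hs; rewrite Rminus_0_r in Hs.
    rewrite Hmod; auto; unfold disk.
    eapply Rle_lt_trans; [apply Cmod_triangle|]; rewrite Cmod_mult, Cmod_R.
    apply (Rmult_lt_compat_r (Cmod b + 1)) in Hs; auto.
    unfold Rdiv in Hs; rewrite Rmult_assoc, Rinv_l in Hs by lra.
    pose proof (Rabs_pos s); lra. }
assert (E : (Cconj (phi z) * d = Cconj z)%C).
{ apply C_eq_Re.
  - specialize (Hdir (RtoC 1)); rewrite !Cmult_1_r in Hdir; exact Hdir.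
  - specialize (Hdir Ci); rewrite Cmult_assoc, Cmult_1_l in Hdir; exact Hdir. }
assert (E2 : (z * Cconj z = phi z * Cconj (phi z))%C).
{ rewrite <- !Cmod2_conj, Hmod; auto. }
assert (Hc : Cconj z <> RtoC 0).
{ intros Hc; apply Hz0, Cmod_eq_0; rewrite <- Cmod_conj, Hc; apply Cmod_0. }
assert (E3 : (Cconj z * (z * d) = Cconj z * phi z)%C).
{ rewrite Cmult_assoc, (Cmult_comm (Cconj z) z), E2, <- Cmult_assoc, E; ring. }
replace (z * d)%C with (/ Cconj z * (Cconj z * (z * d)))%C by (field; auto).
rewrite E3; field; auto.
Qed.

(** By Euler's equation the derivative of [phi (t z) / t] in the real variable [t]
    vanishes. *)
Lemma Cmod_preserving_radial (phi : C -> C) (z : C) (s : R) : analytic phi ->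
  (forall w, disk w -> Cmod (phi w) = Cmod w) -> disk z -> z <> RtoC 0 -> 0 < s < 1 ->
  phi (s * z)%C = (s * phi z)%C.
Proof.
intros Han Hmod Hz Hz0 Hs.
assert (H : forall u, Re (u * phi (s * z)%C)%C = s * Re (u * phi z)%C).
{ intros u.
  assert (H : Re (u * phi (s * z)%C)%C / s = Re (u * phi (1%R * z)%C)%C / 1).
  { apply (eq_is_derive (fun t : R => Re (u * phi (t * z)%C)%C / t)); [|lra].
    intros t Ht.
    assert (Ht0 : RtoC t <> RtoC 0) by (intros E; apply RtoC_inj in E; lra).
    assert (Hd : disk (t * z)%C).
    { unfold disk in *; rewrite Cmod_mult, Cmod_R, Rabs_pos_eq by lra.
      pose proof (Cmod_ge_0 z); nra. }
    assert (Hn : (t * z)%C <> RtoC 0) by (apply Cmult_neq_0; auto).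
    pose proof (Cmod_preserving_euler phi (t * z)%C Han Hmod Hd Hn) as E.
    assert (Hl := cderiv_line phi u (RtoC 0) z (C_derive phi (t * z)%C) t).
    replace (0 + t * z)%C with (t * z)%C in Hl by ring.
    specialize (Hl (analytic_derive phi _ Han Hd)).
    apply (is_derive_ext (K := R_AbsRing) (V := R_NormedModule) _
             (fun t : R => Re (u * phi (t * z)%C)%C)) in Hl.
    2:{ intros r; replace (0 + r * z)%C with (r * z)%C by ring; reflexivity. }
    evar_last.
    - apply (is_derive_div (fun t : R => Re (u * phi (t * z)%C)%C) (fun t => t)).
      + exact Hl.
      + apply (is_derive_id (K := R_AbsRing)).
      + lra.
    - rewrite <- E.
      replace (Re (u * (t * z * C_derive phi (t * z)%C))%C)
        with (t * Re (u * (C_derive phi (t * z)%C * z))%C) by (simpl; ring).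
      unfold one, zero; simpl; field; lra. }
  rewrite Cmult_1_l in H.
  apply (Rmult_eq_reg_r (/ s)); [|apply Rinv_neq_0_compat; lra].
  unfold Rdiv in H; rewrite H; field; lra. }
apply C_eq_Re.
- specialize (H (RtoC 1)); rewrite !Cmult_1_l in H; rewrite H; unfold Re; simpl; ring.
- specialize (H Ci).
  rewrite (Cmult_comm _ Ci), H; unfold Re; simpl; ring.
Qed.

(** Linearity along radii identifies [phi z] with the derivative at 0 applied to [z]. *)
Lemma Cmod_preserving_rotation (phi : C -> C) : analytic phi ->
  (forall w, disk w -> Cmod (phi w) = Cmod w) -> is_rotation phi.
Proof.
intros Han Hmod.
assert (H0 : phi (RtoC 0) = RtoC 0).
{ apply Cmod_eq_0; rewrite Hmod by apply disk_0; apply Cmod_0. }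
set (zeta := C_derive phi (RtoC 0)).
assert (Hz : forall z, disk z -> phi z = (zeta * z)%C).
{ intros z Hz; destruct (Ceq_dec z (RtoC 0)) as [-> | Hn]; [rewrite H0; ring|].
  pose proof (proj1 (Cmod_gt_0 z) Hn) as Hp.
  assert (Hle : Cmod (phi z - z * zeta)%C <= 0).
  { apply le_epsilon; intros e He; rewrite Rplus_0_l.
    pose proof (analytic_derive phi _ Han disk_0) as Hd; fold zeta in Hd.
    rewrite cderiv_eps in Hd.
    destruct (Hd (e / Cmod z)) as [d [Hd0 Hw]]; [apply Rdiv_lt_0_compat; lra|].
    set (s := Rmin (1 / 2) (d / 2)).
    assert (Hs : 0 < s <= 1 / 2 /\ s < d).
    { pose proof (Rmin_l (1 / 2) (d / 2)); pose proof (Rmin_r (1 / 2) (d / 2)).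
      assert (0 < s) by (apply Rmin_pos; lra).
      unfold s in *; lra. }
    specialize (Hw (s * z)%C).
    rewrite (Cmod_preserving_radial phi z s), H0 in Hw by (auto; lra).
    replace (s * z - 0)%C with (s * z)%C in Hw by ring.
    replace (s * phi z - 0 - s * z * zeta)%C with (s * (phi z - z * zeta))%C in Hw by ring.
    rewrite !Cmod_mult, Cmod_R, Rabs_pos_eq in Hw by lra.
    unfold disk in Hz.
    assert (Hsd : s * Cmod z < d) by nra.
    specialize (Hw Hsd).
    apply (Rmult_le_reg_l s); [lra|].
    replace (s * e) with (e / Cmod z * (s * Cmod z)) by (field; lra). exact Hw. }
  pose proof (Cmod_ge_0 (phi z - z * zeta)%C).
  assert (E : (phi z - z * zeta)%C = RtoC 0) by (apply Cmod_eq_0; lra).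
  replace (phi z) with (phi z - z * zeta + z * zeta)%C by ring.
  rewrite E; ring. }
exists zeta; split; auto.
assert (Hh : disk (RtoC (1 / 2))) by (unfold disk; rewrite Cmod_R, Rabs_pos_eq; lra).
pose proof (Hmod _ Hh) as Hm; rewrite Hz, Cmod_mult, Cmod_R, Rabs_pos_eq in Hm by (auto; lra).
lra.
Qed.

(** * Spectra of isometries of a complete normed space *)

Definition seq_complete (V : NormedModule C_AbsRing) : Prop :=
  forall u : nat -> V,
  (forall e, 0 < e -> exists N, forall n m, (N <= n)%nat -> (N <= m)%nat ->
     norm (minus (u n) (u m)) < e) ->
  exists l, forall e, 0 < e -> exists N, forall n, (N <= n)%nat ->
     norm (minus (u n) l) < e.

Lemma minus_plus_r (G : AbelianGroup) (x y : G) : minus (plus x y) y = x.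
Proof.
transitivity (plus x (plus y (opp y))); [symmetry; apply plus_assoc|].
rewrite plus_opp_r; apply plus_zero_r.
Qed.

Lemma plus_minus_r (G : AbelianGroup) (x y : G) : plus (minus x y) y = x.
Proof.
transitivity (plus x (plus (opp y) y)); [symmetry; apply plus_assoc|].
rewrite plus_opp_l; apply plus_zero_r.
Qed.

Lemma minus_minus (G : AbelianGroup) (x y z : G) :
  minus (minus x y) z = minus x (plus y z).
Proof.
transitivity (plus x (plus (opp y) (opp z))); [symmetry; apply plus_assoc|].
rewrite <- opp_plus; reflexivity.
Qed.

Lemma minus_plus_l (G : AbelianGroup) (y a b : G) :
  minus (plus y a) (plus y b) = minus a b.
Proof.
rewrite <- minus_minus; f_equal.
rewrite plus_comm; apply minus_plus_r.
Qed.

(** The bookkeeping of the induction step in [pow_quotient_spec]. *)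
Lemma minus_telescope (G : AbelianGroup) (a b c d e : G) :
  minus b d = minus c e -> minus (plus a b) (plus c d) = minus a e.
Proof.
intros H.
rewrite (plus_comm c d), <- minus_minus.
transitivity (minus (plus a (minus b d)) c); [f_equal; symmetry; apply plus_assoc|].
rewrite H.
transitivity (minus (plus (minus a e) c) c); [f_equal | apply minus_plus_r].
unfold minus; rewrite (plus_comm c); apply plus_assoc.
Qed.

Lemma minus_opp_opp (G : AbelianGroup) (x y : G) : minus (opp x) (opp y) = minus y x.
Proof. unfold minus; rewrite opp_opp; apply plus_comm. Qed.

Lemma scal_Cinv_l (V : NormedModule C_AbsRing) (a : C) (x : V) : a <> RtoC 0 ->
  scal (/ a)%C (scal a x) = x.
Proof.
intros Ha; rewrite scal_assoc; transitivity (scal (one : C_AbsRing) x).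
- f_equal; exact (Cinv_l a Ha).
- exact (scal_one x).
Qed.

Lemma scal_Cinv_r (V : NormedModule C_AbsRing) (a : C) (x : V) : a <> RtoC 0 ->
  scal a (scal (/ a)%C x) = x.
Proof.
intros Ha; rewrite scal_assoc; transitivity (scal (one : C_AbsRing) x).
- f_equal; exact (Cinv_r a Ha).
- exact (scal_one x).
Qed.

Lemma norm_scal_C (V : NormedModule C_AbsRing) (a : C) (x : V) :
  norm (scal a x) = Cmod a * norm x.
Proof.
apply Rle_antisym; [exact (norm_scal a x)|].
destruct (Ceq_dec a (RtoC 0)) as [-> | Ha].
- rewrite Cmod_0, Rmult_0_l; apply norm_ge_0.
- pose proof (norm_scal (/ a)%C (scal a x)) as H.
  rewrite scal_Cinv_l in H by auto.
  change (abs (/ a)%C) with (Cmod (/ a)%C) in H.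
  rewrite Cmod_inv in H by auto.
  pose proof (proj1 (Cmod_gt_0 a) Ha) as Hp.
  apply (Rmult_le_compat_l (Cmod a)) in H; [|lra].
  rewrite <- Rmult_assoc, Rinv_r, Rmult_1_l in H; lra.
Qed.

Lemma norm_minus_self (V : NormedModule C_AbsRing) (x : V) : norm (minus x x) = 0.
Proof. rewrite minus_eq_zero; exact (norm_zero (K := C_AbsRing) (V := V)). Qed.

Lemma norm_minus_sym (V : NormedModule C_AbsRing) (x y : V) :
  norm (minus x y) = norm (minus y x).
Proof. rewrite <- opp_minus; apply norm_opp. Qed.

Lemma norm_minus_triangle (V : NormedModule C_AbsRing) (x y z : V) :
  norm (minus x z) <= norm (minus x y) + norm (minus y z).
Proof. rewrite (minus_trans y x z); apply norm_triangle. Qed.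

Lemma norm_le_minus (V : NormedModule C_AbsRing) (x y : V) :
  norm x <= norm (minus x y) + norm y.
Proof.
apply Rle_trans with (norm (plus (minus x y) y)); [|apply norm_triangle].
right; f_equal; symmetry; exact (plus_minus_r _ x y).
Qed.

Lemma minus_eq_0 (V : NormedModule C_AbsRing) (x y : V) :
  norm (minus x y) = 0 -> x = y.
Proof.
intros H; apply norm_eq_zero in H.
transitivity (plus (minus x y) y); [symmetry; exact (plus_minus_r _ x y)|].
rewrite H; apply plus_zero_l.
Qed.

Lemma is_linear_minus (V : NormedModule C_AbsRing) (A B : V -> V) :
  is_linear A -> is_linear B -> is_linear (fun x => minus (A x) (B x)).
Proof.
intros HA HB.
apply (is_linear_comp (fun x => (A x, opp (B x))) (fun t : V * V => plus (fst t) (snd t))).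
- apply is_linear_prod; auto; apply (is_linear_comp B opp); auto; apply is_linear_opp.
- apply is_linear_plus.
Qed.

Lemma is_linear_scal_C (V : NormedModule C_AbsRing) (a : C) :
  is_linear (fun x : V => scal a x).
Proof. apply (is_linear_scal_r (K := C_AbsRing)); exact Cmult_comm. Qed.

Lemma contraction_fixpoint (V : NormedModule C_AbsRing) (g : V -> V) (q : R) :
  seq_complete V -> 0 <= q < 1 ->
  (forall x y, norm (minus (g x) (g y)) <= q * norm (minus x y)) ->
  exists l, g l = l.
Proof.
intros Hc Hq Hg.
set (u := fun n => Nat.iter n g (zero : V)).
set (D := norm (minus (u 1%nat) (u O))).
assert (Hstep : forall n, norm (minus (u (S n)) (u n)) <= D * q ^ n).
{ induction n as [|n IH]; [simpl pow; unfold D; lra|].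
  pose proof (Hg (u (S n)) (u n)) as H.
  change (g (u (S n))) with (u (S (S n))) in H; change (g (u n)) with (u (S n)) in H.
  simpl pow; nra. }
assert (HD : 0 <= D) by apply norm_ge_0.
assert (Hdist : forall n k,
  (1 - q) * norm (minus (u (k + n)%nat) (u n)) <= D * q ^ n * (1 - q ^ k)).
{ intros n k; induction k as [|k IH].
  - simpl Nat.add; rewrite norm_minus_self; simpl; lra.
  - pose proof (norm_minus_triangle V (u (S k + n)%nat) (u (k + n)%nat) (u n)) as Ht.
    pose proof (Hstep (k + n)%nat) as Hs; rewrite pow_add in Hs.
    change (S (k + n)) with (S k + n)%nat in Hs; simpl pow. nra. }
assert (Hcauchy : forall e, 0 < e -> exists N, forall n k, (N <= n)%nat ->
  norm (minus (u (k + n)%nat) (u n)) < e).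
{ intros e He.
  destruct (pow_lt_1_zero q) with (y := e * (1 - q) / (D + 1)) as [N HN].
  { rewrite Rabs_pos_eq; lra. }
  { apply Rdiv_lt_0_compat; nra. }
  exists N; intros n k Hn; specialize (HN n Hn); specialize (Hdist n k).
  pose proof (pow_le q n (proj1 Hq)) as Hpn; pose proof (pow_le q k (proj1 Hq)) as Hpk.
  rewrite Rabs_pos_eq in HN by auto.
  apply (Rmult_lt_compat_r (D + 1)) in HN; [|lra].
  unfold Rdiv in HN; rewrite (Rmult_assoc _ (/ (D + 1))), Rinv_l, Rmult_1_r in HN by lra.
  assert (0 <= D * q ^ n) by (apply Rmult_le_pos; auto).
  assert (D * q ^ n * (1 - q ^ k) <= D * q ^ n) by nra.
  apply (Rmult_lt_reg_l (1 - q)); nra. }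
destruct (Hc u) as [l Hl].
{ intros e He; destruct (Hcauchy e He) as [N HN]; exists N; intros n m Hn Hm.
  destruct (Nat.le_ge_cases n m) as [H | H].
  - rewrite norm_minus_sym; replace m with ((m - n) + n)%nat by lia; auto.
  - replace n with ((n - m) + m)%nat by lia; auto. }
exists l; apply minus_eq_0; apply Rle_antisym; [|apply norm_ge_0].
apply le_epsilon; intros e He; rewrite Rplus_0_l.
destruct (Hl (e / 2)) as [N HN]; [lra|].
pose proof (HN N (le_n N)) as H1; pose proof (HN (S N) (le_S _ _ (le_n N))) as H2.
pose proof (Hg l (u N)) as H3; change (g (u N)) with (u (S N)) in H3.
pose proof (norm_minus_triangle V (g l) (u (S N)) l) as H4.
rewrite (norm_minus_sym V l) in H3.
pose proof (norm_ge_0 (minus (u N) l)). nra.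
Qed.

(** Invertibility in the form in which it is stable under small perturbations. *)
Definition onto_below {V : NormedModule C_AbsRing} (K : R) (A : V -> V) : Prop :=
  0 < K /\ (forall y, exists x, A x = y) /\ (forall x, norm x <= K * norm (A x)).

Lemma onto_below_inj (V : NormedModule C_AbsRing) (K : R) (A : V -> V) (x y : V) :
  is_linear A -> onto_below K A -> A x = A y -> x = y.
Proof.
intros HA [_ [_ HK]] H; apply minus_eq_0.
specialize (HK (minus x y)); rewrite (linear_minus A), H, norm_minus_self in HK; auto.
pose proof (norm_ge_0 (minus x y)); lra.
Qed.

Lemma onto_below_invertible (V : NormedModule C_AbsRing) (K : R) (A : V -> V) :
  is_linear A -> onto_below K A -> invertible A.
Proof.
intros HA H; pose proof H as [HK0 [Hs HK]].
destruct (choice _ Hs) as [S HS].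
exists S; split; [split|split]; auto.
- intros x y; apply (onto_below_inj V K A); auto.
  rewrite (linear_plus A), !HS; auto.
- intros k x; apply (onto_below_inj V K A); auto.
  rewrite (linear_scal A), !HS; auto.
- exists K; split; auto; intros x; specialize (HK (S x)); rewrite HS in HK; auto.
- intros x; apply (onto_below_inj V K A); auto.
Qed.

Lemma invertible_onto_below (V : NormedModule C_AbsRing) (A : V -> V) :
  invertible A -> exists K, onto_below K A.
Proof.
intros [S [HS [H1 H2]]]; destruct (linear_norm S HS) as [M [HM HMx]].
exists M; split; [auto|split].
- intros y; exists (S y); auto.
- intros x; rewrite <- (H1 x) at 1; auto.
Qed.

(** Solve [A x = y + B x] by iterating the contraction [x |-> A^-1 (y + B x)]. *)
Lemma onto_below_perturb (V : NormedModule C_AbsRing) (K b : R) (A B : V -> V) :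
  seq_complete V -> is_linear A -> is_linear B -> onto_below K A ->
  0 <= b -> (forall x, norm (B x) <= b * norm x) -> K * b < 1 ->
  exists K', onto_below K' (fun x => minus (A x) (B x)).
Proof.
intros Hc HA HB [HK0 [Hs HK]] Hb0 Hb Hlt.
exists (K / (1 - K * b)); split; [|split].
- apply Rdiv_lt_0_compat; lra.
- intros y; destruct (choice _ Hs) as [S HS].
  destruct (contraction_fixpoint V (fun x => S (plus y (B x))) (K * b) Hc) as [l Hl].
  + split; auto; apply Rmult_le_pos; lra.
  + intros x x'; eapply Rle_trans; [apply HK|].
    rewrite (linear_minus A), !HS by auto.
    replace (minus (plus y (B x)) (plus y (B x'))) with (B (minus x x')).
    * specialize (Hb (minus x x')); rewrite Rmult_assoc; apply Rmult_le_compat_l; lra.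
    * rewrite (linear_minus B) by auto; symmetry; exact (minus_plus_l _ y (B x) (B x')).
  + exists l; rewrite <- Hl at 1; rewrite HS; exact (minus_plus_r _ y (B l)).
- intros x; specialize (HK x); specialize (Hb x).
  assert (Ht : norm (A x) <= norm (minus (A x) (B x)) + norm (B x)) by apply norm_le_minus.
  apply (Rmult_le_reg_l (1 - K * b)); [lra|].
  replace ((1 - K * b) * (K / (1 - K * b) * norm (minus (A x) (B x))))
    with (K * norm (minus (A x) (B x))) by (field; lra).
  nra.
Qed.

Notation shifted T lambda := (fun x => minus (T x) (scal lambda x)).

Lemma is_linear_shift (V : NormedModule C_AbsRing) (T : V -> V) (lambda : C) :
  is_linear T -> is_linear (shifted T lambda).
Proof. intros HT; apply is_linear_minus; auto; apply is_linear_scal_C. Qed.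

(** The resolvent set is open: moving [lambda] perturbs by a small scalar operator. *)
Lemma onto_below_shift (V : NormedModule C_AbsRing) (T : V -> V) (K : R) (lambda mu : C) :
  seq_complete V -> is_linear T -> onto_below K (shifted T lambda) ->
  K * Cmod (mu - lambda)%C < 1 -> exists K', onto_below K' (shifted T mu).
Proof.
intros Hc HT H Hlt.
destruct (onto_below_perturb V K (Cmod (mu - lambda)%C) (shifted T lambda)
  (fun x => scal (mu - lambda)%C x)) as [K' HK']; auto.
- apply is_linear_shift; auto.
- apply is_linear_scal_C.
- apply Cmod_ge_0.
- intros x; rewrite norm_scal_C; lra.
- exists K'; replace (shifted T mu) with
    (fun x => minus (shifted T lambda x) (scal (mu - lambda)%C x)); auto.
  apply functional_extensionality; intros x.
  transitivity (minus (T x) (plus (scal lambda x) (scal (mu - lambda)%C x))).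
  + exact (minus_minus _ _ _ _).
  + f_equal; transitivity (scal (lambda + (mu - lambda))%C x).
    * symmetry; exact (scal_distr_r (K := C_Ring) lambda (mu - lambda)%C x).
    * f_equal; ring.
Qed.

Definition isometry {V : NormedModule C_AbsRing} (T : V -> V) : Prop :=
  is_linear T /\ forall x, norm (T x) = norm x.

(** By the triangle inequality [|T x - mu x| >= (1 - |mu|) |x|]; the constant is uniform in
    [|mu| <= r], which lets the same step length be used all along a segment. *)
Lemma isometry_shift_below (V : NormedModule C_AbsRing) (T : V -> V) (mu : C) (r : R) :
  isometry T -> Cmod mu <= r -> r < 1 -> (forall y, exists x, shifted T mu x = y) ->
  onto_below (/ (1 - r)) (shifted T mu).
Proof.
intros [_ HT] Hmu Hr Hs; split; [|split]; auto.
- apply Rinv_0_lt_compat; lra.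
- intros x.
  pose proof (norm_le_minus V (T x) (scal mu x)) as H.
  rewrite HT, norm_scal_C in H.
  apply (Rmult_le_reg_l (1 - r)); [lra|].
  rewrite <- Rmult_assoc, Rinv_r, Rmult_1_l by lra.
  pose proof (norm_ge_0 x). nra.
Qed.

Lemma shift_0_onto (V : NormedModule C_AbsRing) (T : V -> V) :
  (forall y, exists x, shifted T (RtoC 0) x = y) <-> (forall y, exists x, T x = y).
Proof.
assert (E : forall x : V, shifted T (RtoC 0) x = T x).
{ intros x; replace (scal (RtoC 0) x) with (zero : V); [exact (@minus_zero_r V (T x))|].
  symmetry; exact (scal_zero_l (K := C_Ring) (V := V) x). }
split; intros H y; destruct (H y) as [x Hx]; exists x; rewrite E in *; auto.
Qed.

(** Inside the disk the lower bound for [T - mu] is uniform along the segment from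
    [lambda] to 0, so surjectivity propagates along it in finitely many steps. *)
Lemma isometry_shift_onto (V : NormedModule C_AbsRing) (T : V -> V) (lambda : C) :
  seq_complete V -> isometry T -> Cmod lambda < 1 ->
  (forall y, exists x, shifted T lambda x = y) -> forall y, exists x, T x = y.
Proof.
intros Hc HT Hl Hs; apply shift_0_onto.
(* [N] steps of length [|lambda| / N], each shorter than the reciprocal of the uniform
   bound [/ (1 - |lambda|)]. *)
set (r := Cmod lambda) in *.
assert (Hr0 : 0 <= r) by apply Cmod_ge_0.
destruct (INR_unbounded (/ (1 - r) * r)) as [N HN].
assert (Hinv : 0 < / (1 - r)) by (apply Rinv_0_lt_compat; lra).
assert (HN0 : 0 < INR N) by nra.
assert (Hj : forall j, (j <= N)%nat ->
  forall y, exists x, shifted T (RtoC (1 - INR j / INR N) * lambda)%C x = y).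
{ induction j as [|j IH]; intros Hj.
  - simpl INR; replace (RtoC (1 - 0 / INR N) * lambda)%C with lambda; auto.
    replace (1 - 0 / INR N) with 1 by (field; lra); ring.
  - assert (Hjn : 0 <= INR j / INR N <= 1).
    { pose proof (pos_INR j); assert (INR j <= INR N) by (apply le_INR; lia).
      split; [apply Rdiv_le_0_compat; lra|].
      apply (Rmult_le_reg_r (INR N)); auto; unfold Rdiv.
      rewrite Rmult_assoc, Rinv_l; lra. }
    assert (Hb := isometry_shift_below V T (RtoC (1 - INR j / INR N) * lambda)%C r HT).
    rewrite Cmod_mult, Cmod_R, Rabs_pos_eq in Hb by lra; fold r in Hb.
    assert (Hb' := Hb ltac:(nra) Hl (IH ltac:(lia))).
    destruct (onto_below_shift V T _ _ (RtoC (1 - INR (S j) / INR N) * lambda)%C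
      Hc (proj1 HT) Hb')
      as [K' [_ [HK' _]]]; auto.
    replace (RtoC (1 - INR (S j) / INR N) * lambda - RtoC (1 - INR j / INR N) * lambda)%C
      with (RtoC (- / INR N) * lambda)%C.
    + rewrite Cmod_mult, Cmod_R, Rabs_Ropp, Rabs_pos_eq; fold r.
      * apply (Rmult_lt_reg_r (INR N)); auto.
        replace (/ (1 - r) * (/ INR N * r) * INR N) with (/ (1 - r) * r) by (field; lra).
        lra.
      * left; apply Rinv_0_lt_compat; auto.
    + replace (- / INR N) with ((1 - INR (S j) / INR N) - (1 - INR j / INR N)).
      * rewrite (RtoC_minus (1 - INR (S j) / INR N)); ring.
      * rewrite S_INR; field; lra. }
specialize (Hj N (le_n N)).
replace (RtoC (1 - INR N / INR N) * lambda)%C with (RtoC 0) in Hj; auto.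
replace (1 - INR N / INR N) with 0 by (field; lra); ring.
Qed.

(** [lambda] dominates [T]: a Neumann series in [T / lambda]. *)
Lemma isometry_shift_outside (V : NormedModule C_AbsRing) (T : V -> V) (lambda : C) :
  seq_complete V -> isometry T -> 1 < Cmod lambda -> invertible (shifted T lambda).
Proof.
intros Hc [HT Hn] Hl.
assert (Hl0 : lambda <> RtoC 0) by (intros ->; rewrite Cmod_0 in Hl; lra).
assert (HA : is_linear (fun x : V => opp (scal lambda x))).
{ apply (is_linear_comp (fun x : V => scal lambda x) opp);
    [apply is_linear_scal_C | apply is_linear_opp]. }
destruct (onto_below_perturb V (/ Cmod lambda) 1 (fun x => opp (scal lambda x))
  (fun x => opp (T x))) as [K' HK']; auto.
- apply (is_linear_comp T opp); auto; apply is_linear_opp.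
- split; [apply Rinv_0_lt_compat; lra | split].
  + intros y; exists (scal (/ lambda)%C (opp y)).
    rewrite scal_Cinv_r by auto; exact (@opp_opp V y).
  + intros x; right; transitivity (/ Cmod lambda * norm (scal lambda x)).
    * rewrite norm_scal_C; field; lra.
    * f_equal; symmetry; exact (norm_opp (scal lambda x)).
- lra.
- intros x; rewrite norm_opp, Hn; lra.
- rewrite Rmult_1_r, <- Rinv_1; apply Rinv_lt_contravar; lra.
- apply (onto_below_invertible V K'); [apply is_linear_shift; auto|].
  replace (shifted T lambda) with (fun x => minus (opp (scal lambda x)) (opp (T x))); auto.
  apply functional_extensionality; intros x; exact (minus_opp_opp _ _ _).
Qed.

(** [T] is invertible with an isometric inverse, and dominates [lambda]. *)
Lemma isometry_onto_shift_inside (V : NormedModule C_AbsRing) (T : V -> V) (lambda : C) :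
  seq_complete V -> isometry T -> (forall y, exists x, T x = y) ->
  Cmod lambda < 1 -> invertible (shifted T lambda).
Proof.
intros Hc HT Hs Hl.
destruct (onto_below_perturb V 1 (Cmod lambda) T (fun x => scal lambda x)) as [K HK]; auto.
- apply HT.
- apply is_linear_scal_C.
- split; [lra | split]; auto; intros x; destruct HT as [_ ->]; lra.
- apply Cmod_ge_0.
- intros x; rewrite norm_scal_C; lra.
- lra.
- apply (onto_below_invertible V K); auto; apply is_linear_shift, HT.
Qed.

(** If [T - lambda] were invertible with [|lambda| <= 1], so would be [T - mu] for some
    [mu] in the open disk, and then [T] itself would be onto. *)
Lemma spectrum_isometry_not_onto (V : NormedModule C_AbsRing) (T : V -> V) :
  seq_complete V -> isometry T -> ~ (forall y, exists x, T x = y) ->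
  forall lambda, spectrum T lambda <-> Cmod lambda <= 1.
Proof.
intros Hc HT Hs lambda; split.
- intros H; apply Rnot_lt_le; intros Hl; apply H.
  apply isometry_shift_outside; auto.
- intros Hl H; apply Hs.
  destruct (invertible_onto_below V _ H) as [K HK].
  assert (HK0 : 0 < K) by apply HK.
  assert (Hinv : 0 < / (K + 1) < 1).
  { split; [apply Rinv_0_lt_compat; lra|].
    rewrite <- Rinv_1; apply Rinv_lt_contravar; lra. }
  destruct (onto_below_shift V T K lambda (RtoC (1 - / (K + 1)) * lambda)%C Hc (proj1 HT) HK)
    as [K' [_ [HK' _]]].
  + replace (RtoC (1 - / (K + 1)) * lambda - lambda)%C with (RtoC (- / (K + 1)) * lambda)%C.
    * rewrite Cmod_mult, Cmod_R, Rabs_Ropp, Rabs_pos_eq by lra.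
      assert (K * / (K + 1) < 1).
      { apply (Rmult_lt_reg_r (K + 1)); [lra|]; rewrite Rmult_assoc, Rinv_l; lra. }
      assert (0 <= K * / (K + 1)) by (apply Rmult_le_pos; lra).
      pose proof (Cmod_ge_0 lambda); rewrite <- Rmult_assoc. nra.
    * rewrite RtoC_minus, RtoC_opp; ring.
  + apply (isometry_shift_onto V T (RtoC (1 - / (K + 1)) * lambda)%C); auto.
    rewrite Cmod_mult, Cmod_R, Rabs_pos_eq by lra.
    pose proof (Cmod_ge_0 lambda). nra.
Qed.

Lemma spectrum_isometry_onto (V : NormedModule C_AbsRing) (T : V -> V) :
  seq_complete V -> isometry T -> (forall y, exists x, T x = y) ->
  forall lambda, spectrum T lambda -> Cmod lambda = 1.
Proof.
intros Hc HT Hs lambda H.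
destruct (Rtotal_order (Cmod lambda) 1) as [Hl | [Hl | Hl]]; auto; exfalso; apply H.
- apply isometry_onto_shift_inside; auto.
- apply isometry_shift_outside; auto.
Qed.

(** On such vectors no inverse of [T - lambda] can be bounded. *)
Lemma approx_eigenvalue_spectrum (V : NormedModule C_AbsRing) (T : V -> V) (lambda : C) :
  (forall e, 0 < e -> exists x, 0 < norm x /\ norm (shifted T lambda x) <= e * norm x) ->
  spectrum T lambda.
Proof.
intros H Hinv; destruct (invertible_onto_below V _ Hinv) as [K [HK0 [_ HK]]].
destruct (H (/ (2 * K))) as [x [Hx Hle]]; [apply Rinv_0_lt_compat; lra|].
specialize (HK x).
assert (K * norm (minus (T x) (scal lambda x)) <= K * (/ (2 * K) * norm x))
  by (apply Rmult_le_compat_l; lra).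
replace (K * (/ (2 * K) * norm x)) with (norm x / 2) in * by (field; lra).
lra.
Qed.

(** The quotient [(T^n - lambda^n) / (T - lambda)]. *)
Fixpoint pow_quotient {V : NormedModule C_AbsRing} (T : V -> V) (lambda : C) (n : nat)
  (x : V) : V :=
  match n with
  | O => zero
  | S m => plus (Nat.iter m T x) (scal lambda (pow_quotient T lambda m x))
  end.

Lemma is_linear_iter (V : NormedModule C_AbsRing) (T : V -> V) (n : nat) :
  is_linear T -> is_linear (Nat.iter n T).
Proof.
intros HT; induction n as [|n IH]; [apply (is_linear_id (K := C_AbsRing))|].
exact (is_linear_comp (Nat.iter n T) T IH HT).
Qed.

Lemma is_linear_pow_quotient (V : NormedModule C_AbsRing) (T : V -> V) (lambda : C) (n : nat) :
  is_linear T -> is_linear (pow_quotient T lambda n).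
Proof.
intros HT; induction n as [|n IH]; [apply (is_linear_zero (K := C_AbsRing))|].
apply (is_linear_comp (fun x => (Nat.iter n T x, scal lambda (pow_quotient T lambda n x)))
                      (fun t : V * V => plus (fst t) (snd t))).
- apply is_linear_prod; [apply is_linear_iter; auto|].
  apply (is_linear_comp (pow_quotient T lambda n) (fun x => scal lambda x)); auto.
  apply is_linear_scal_C.
- apply is_linear_plus.
Qed.

Lemma pow_quotient_comm (V : NormedModule C_AbsRing) (T : V -> V) (lambda : C) (n : nat)
  (x : V) : is_linear T -> pow_quotient T lambda n (T x) = T (pow_quotient T lambda n x).
Proof.
intros HT; induction n as [|n IH]; [symmetry; apply linear_zero; auto|].
cbn [pow_quotient]; rewrite (linear_plus T), (linear_scal T), IH by auto; f_equal.
rewrite <- Nat.iter_succ_r; reflexivity.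
Qed.

Lemma pow_quotient_spec (V : NormedModule C_AbsRing) (T : V -> V) (lambda : C) (n : nat)
  (x : V) : is_linear T ->
  shifted T lambda (pow_quotient T lambda n x) = minus (Nat.iter n T x) (scal (lambda ^ n)%C x).
Proof.
intros HT; induction n as [|n IH].
- cbn [pow_quotient Nat.iter]; rewrite linear_zero by auto.
  transitivity (zero : V).
  + transitivity (minus (zero : V) zero); [f_equal | exact (@minus_eq_zero V zero)].
    exact (scal_zero_r (K := C_Ring) (V := V) lambda).
  + symmetry; transitivity (minus x x); [f_equal | exact (@minus_eq_zero V x)].
    exact (scal_one (K := C_Ring) (V := V) x).
- cbn [pow_quotient].
  rewrite (linear_plus T), (linear_scal T) by auto.
  transitivity (minus
    (plus (Nat.iter (S n) T x) (scal lambda (T (pow_quotient T lambda n x))))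
    (plus (scal lambda (Nat.iter n T x))
          (scal lambda (scal lambda (pow_quotient T lambda n x))))).
  + f_equal; exact (scal_distr_l (K := C_Ring) (V := V) lambda _ _).
  + transitivity (minus (Nat.iter (S n) T x) (scal lambda (scal (lambda ^ n)%C x))).
    * apply (minus_telescope V).
      pose proof (is_linear_scal_C V lambda) as Hl.
      transitivity (scal lambda (shifted T lambda (pow_quotient T lambda n x))).
      -- symmetry; exact (linear_minus _ _ _ Hl).
      -- rewrite IH; exact (linear_minus _ _ _ Hl).
    * f_equal; exact (scal_assoc (K := C_Ring) (V := V) lambda (lambda ^ n)%C x).
Qed.

(** When [T^n] is the scalar [mu], the quotient above inverts [T - lambda] up to the
    factor [mu - lambda^n]. *)
Lemma scalar_power_shift_invertible (V : NormedModule C_AbsRing) (T : V -> V)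
  (lambda mu : C) (n : nat) : is_linear T ->
  (forall x, Nat.iter n T x = scal mu x) -> (lambda ^ n)%C <> mu ->
  invertible (shifted T lambda).
Proof.
intros HT Hmu Hne.
assert (Hd : (mu - lambda ^ n)%C <> RtoC 0).
{ intros E; apply Hne.
  replace mu with (mu - lambda ^ n + lambda ^ n)%C by ring; rewrite E; ring. }
assert (HQ := is_linear_pow_quotient V T lambda n HT).
assert (Hspec : forall x, shifted T lambda (pow_quotient T lambda n x)
                        = scal (mu - lambda ^ n)%C x).
{ intros x; rewrite pow_quotient_spec, Hmu by auto; symmetry.
  transitivity (plus (scal mu x) (scal (- lambda ^ n)%C x)).
  - exact (scal_distr_r (K := C_Ring) (V := V) mu (- lambda ^ n)%C x).
  - apply (f_equal (plus (scal mu x))).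
    exact (scal_opp_l (K := C_Ring) (V := V) (lambda ^ n)%C x). }
assert (Hs := is_linear_shift V T lambda HT).
exists (fun x => scal (/ (mu - lambda ^ n))%C (pow_quotient T lambda n x)).
split; [|split].
- apply (is_linear_comp (pow_quotient T lambda n)); auto; apply is_linear_scal_C.
- intros x.
  replace (pow_quotient T lambda n (minus (T x) (scal lambda x)))
    with (scal (mu - lambda ^ n)%C x); [apply scal_Cinv_l; auto|].
  rewrite <- Hspec, (linear_minus (pow_quotient T lambda n)), pow_quotient_comm by auto.
  rewrite (linear_scal (pow_quotient T lambda n)); auto.
- intros x; cbv beta.
  transitivity (scal (/ (mu - lambda ^ n))%C (shifted T lambda (pow_quotient T lambda n x))).
  + exact (linear_scal _ Hs (/ (mu - lambda ^ n))%C (pow_quotient T lambda n x)).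
  + rewrite Hspec; apply scal_Cinv_l; auto.
Qed.

(** * Completeness of the Bloch space *)

Definition Clim (a : nat -> C) (l : C) : Prop :=
  forall e, 0 < e -> exists N, forall n, (N <= n)%nat -> Cmod (a n - l)%C < e.

Lemma Cmod_fst (x : C) : Rabs (fst x) <= Cmod x.
Proof. eapply Rle_trans; [apply Rmax_l | apply Rmax_Cmod]. Qed.

Lemma Cmod_snd (x : C) : Rabs (snd x) <= Cmod x.
Proof. eapply Rle_trans; [apply Rmax_r | apply Rmax_Cmod]. Qed.

Lemma Cmod_le_abs (x : C) : Cmod x <= Rabs (fst x) + Rabs (snd x).
Proof.
replace x with (RtoC (fst x) + RtoC (snd x) * Ci)%C at 1.
- eapply Rle_trans; [apply Cmod_triangle|].
  rewrite Cmod_mult, !Cmod_R, Cmod_Ci; lra.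
- destruct x; unfold RtoC, Ci, Cplus, Cmult; simpl; f_equal; ring.
Qed.

Lemma C_cauchy_lim (a : nat -> C) :
  (forall e, 0 < e -> exists N, forall n m, (N <= n)%nat -> (N <= m)%nat ->
     Cmod (a n - a m)%C < e) -> exists l, Clim a l.
Proof.
intros Ha.
destruct (Rcomplete.R_complete (fun n => fst (a n))) as [x Hx].
{ intros e He; destruct (Ha e He) as [N HN]; exists N; intros n m Hn Hm.
  eapply Rle_lt_trans; [|apply (HN n m Hn Hm)]; apply (Cmod_fst (a n - a m)%C). }
destruct (Rcomplete.R_complete (fun n => snd (a n))) as [y Hy].
{ intros e He; destruct (Ha e He) as [N HN]; exists N; intros n m Hn Hm.
  eapply Rle_lt_trans; [|apply (HN n m Hn Hm)]; apply (Cmod_snd (a n - a m)%C). }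
exists (x, y); intros e He.
destruct (Hx (e / 2)) as [N1 H1]; [lra|]; destruct (Hy (e / 2)) as [N2 H2]; [lra|].
exists (Nat.max N1 N2); intros n Hn.
eapply Rle_lt_trans; [apply Cmod_le_abs|].
specialize (H1 n ltac:(lia)); specialize (H2 n ltac:(lia)).
change (Rabs (fst (a n) - x) < e / 2) in H1; change (Rabs (snd (a n) - y) < e / 2) in H2.
change (Rabs (fst (a n) - x) + Rabs (snd (a n) - y) < e); lra.
Qed.

Lemma Clim_minus (a b : nat -> C) (x y : C) : Clim a x -> Clim b y ->
  Clim (fun n => a n - b n)%C (x - y)%C.
Proof.
intros Ha Hb e He.
destruct (Ha (e / 2)) as [N1 H1]; [lra|]; destruct (Hb (e / 2)) as [N2 H2]; [lra|].
exists (Nat.max N1 N2); intros n Hn.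
specialize (H1 n ltac:(lia)); specialize (H2 n ltac:(lia)).
replace (a n - b n - (x - y))%C with ((a n - x) + - (b n - y))%C by ring.
eapply Rle_lt_trans; [apply Cmod_triangle|]; rewrite Cmod_opp; lra.
Qed.

Lemma Clim_le (a : nat -> C) (l x : C) (N : nat) (b : R) : Clim a l ->
  (forall n, (N <= n)%nat -> Cmod (a n - x)%C <= b) -> Cmod (l - x)%C <= b.
Proof.
intros Ha Hb; apply le_epsilon; intros e He.
destruct (Ha e He) as [M HM].
specialize (HM (Nat.max M N) ltac:(lia)); specialize (Hb (Nat.max M N) ltac:(lia)).
replace (l - x)%C with ((a (Nat.max M N) - x) + - (a (Nat.max M N) - l))%C by ring.
eapply Rle_trans; [apply Cmod_triangle|]; rewrite Cmod_opp; lra.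
Qed.

Lemma bloch_minus_on (f g : bloch) (z : C) : disk z -> (minus f g : bloch) z = (f z - g z)%C.
Proof.
intros Hz; change ((minus f g : bloch) z) with (bloch_plus f (bloch_opp g) z).
rewrite bloch_plus_on, bloch_opp_on by auto; ring.
Qed.

Lemma cderiv_bloch (f : bloch) (z : C) : disk z -> cderiv f z (C_derive f z).
Proof. intros Hz; apply analytic_derive; auto; apply bloch_in. Qed.

Lemma C_derive_bloch_minus (f g : bloch) (z : C) : disk z ->
  C_derive (minus f g : bloch) z = (C_derive f z - C_derive g z)%C.
Proof.
intros Hz; apply is_C_derive_unique.
apply (derive_ext_disk (fun w => f w - g w)%C); auto.
- intros; symmetry; apply bloch_minus_on; auto.
- apply cderiv_minus; apply cderiv_bloch; auto.
Qed.

Lemma bloch_eval_bound (f : bloch) (z : C) : disk z ->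
  Cmod (f z) <= (1 + rho (Cmod z)) * norm f.
Proof.
intros Hz; change (norm f) with (bloch_norm f); unfold bloch_norm.
pose proof (bloch_growth f z (bloch_in f) Hz) as H.
pose proof (rho_ge_0 _ (disk_Cmod z Hz)); pose proof (Cmod_ge_0 (f (RtoC 0))).
pose proof (seminorm_ge_0 f (bloch_in f)).
replace (f z) with (f z - f (RtoC 0) + f (RtoC 0))%C by ring.
eapply Rle_trans; [apply Cmod_triangle|]; nra.
Qed.

Lemma bloch_derive_bound (f : bloch) (z : C) : disk z ->
  (1 - Cmod z ^ 2) * Cmod (C_derive f z) <= norm f.
Proof.
intros Hz; pose proof (seminorm_ge f z (bloch_in f) Hz).
change (norm f) with (bloch_norm f); unfold bloch_norm.
pose proof (Cmod_ge_0 (f (RtoC 0))); lra.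
Qed.

Lemma bloch_norm_minus_le (f g : bloch) (b1 b2 : R) :
  Cmod (f (RtoC 0) - g (RtoC 0))%C <= b1 ->
  (forall z, disk z -> (1 - Cmod z ^ 2) * Cmod (C_derive f z - C_derive g z)%C <= b2) ->
  norm (minus f g) <= b1 + b2.
Proof.
intros H1 H2; change (norm (minus f g)) with (bloch_norm (minus f g)).
unfold bloch_norm; rewrite bloch_minus_on by apply disk_0.
destruct (seminorm_le (minus f g) b2) as [_ H]; [|lra].
intros z Hz; rewrite C_derive_bloch_minus; auto.
Qed.

(** The derivatives converge uniformly on every smaller disk, so the mean value
    inequality lets the limit and the derivative be exchanged. *)
Lemma bloch_limit_derive (u : nat -> bloch) (F G : C -> C) (z : C) :
  (forall e, 0 < e -> exists N, forall n m, (N <= n)%nat -> (N <= m)%nat ->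
     norm (minus (u n) (u m)) < e) ->
  (forall w, disk w -> Clim (fun n => u n w) (F w)) ->
  (forall w, disk w -> Clim (fun n => C_derive (u n) w) (G w)) ->
  disk z -> cderiv F z (G z).
Proof.
intros Hu HF HG Hz; apply cderiv_eps; intros e He.
pose proof (disk_Cmod z Hz) as Hz1.
set (r := (1 + Cmod z) / 2).
assert (Hr : Cmod z < r < 1) by (unfold r; lra).
set (c := 1 - r ^ 2).
assert (Hc : 0 < c) by (unfold c; nra).
assert (Hec : 0 < e / 3 * c) by nra.
destruct (Hu _ Hec) as [N HN].
assert (Hder : forall m w, (N <= m)%nat -> Cmod w <= r ->
  Cmod (C_derive (u m) w - C_derive (u N) w)%C <= e / 3).
{ intros m w Hm Hw.
  assert (Hwd : disk w) by (unfold disk; lra).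
  pose proof (bloch_derive_bound (minus (u m) (u N)) w Hwd) as H.
  rewrite C_derive_bloch_minus in H by auto.
  specialize (HN m N Hm (le_n N)).
  pose proof (Cmod_ge_0 w) as Hw0.
  assert (Hcw : c <= 1 - Cmod w ^ 2) by (unfold c; nra).
  set (x := Cmod (C_derive (u m) w - C_derive (u N) w)%C) in *.
  assert (0 <= x) by apply Cmod_ge_0.
  apply (Rmult_le_reg_l c); nra. }
assert (Hd := cderiv_bloch (u N) z Hz).
rewrite cderiv_eps in Hd; destruct (Hd (e / 3)) as [d1 [Hd1 Hw1]]; [lra|].
exists (Rmin d1 ((1 - Cmod z) / 2)); split; [apply Rmin_pos; lra|].
intros w Hw.
pose proof (Rmin_l d1 ((1 - Cmod z) / 2)); pose proof (Rmin_r d1 ((1 - Cmod z) / 2)).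
specialize (Hw1 w ltac:(lra)).
assert (Hseg : forall t, 0 <= t <= 1 -> Cmod (z + t * (w - z))%C <= r).
{ intros t Ht; eapply Rle_trans; [apply Cmod_triangle|].
  rewrite Cmod_mult, Cmod_R, Rabs_pos_eq by lra.
  pose proof (Cmod_ge_0 (w - z)%C). unfold r; nra. }
assert (Hwd : disk w).
{ specialize (Hseg 1 ltac:(lra)); replace (z + 1%R * (w - z))%C with w in Hseg by ring.
  unfold disk; lra. }
assert (H1 : forall m, (N <= m)%nat ->
  Cmod (u m w - u m z - (u N w - u N z))%C <= e / 3 * Cmod (w - z)%C).
{ intros m Hm.
  assert (H1 := segment_growth (fun x => u m x - u N x)%C
    (fun x => C_derive (u m) x - C_derive (u N) x)%C z w
    (fun t => t * (e / 3 * Cmod (w - z)%C)) (fun _ => e / 3 * Cmod (w - z)%C)).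
  cbv beta in H1.
  replace (u m w - u m z - (u N w - u N z))%C with (u m w - u N w - (u m z - u N z))%C by ring.
  rewrite Rmult_1_l, Rmult_0_l, Rminus_0_r in H1.
  apply H1; intros t Ht; specialize (Hseg t Ht).
  - assert (disk (z + t * (w - z))%C) by (unfold disk; lra).
    apply cderiv_minus; apply cderiv_bloch; auto.
  - auto_derive; auto; ring.
  - apply Rmult_le_compat_r; [apply Cmod_ge_0 | auto]. }
assert (H2 : Cmod (F w - F z - (u N w - u N z))%C <= e / 3 * Cmod (w - z)%C).
{ apply (Clim_le (fun n => u n w - u n z)%C _ _ N); auto.
  apply Clim_minus; auto. }
assert (H3 : Cmod (G z - C_derive (u N) z)%C <= e / 3).
{ apply (Clim_le (fun n => C_derive (u n) z) _ _ N); auto.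
  intros n Hn; apply Hder; auto; lra. }
replace (F w - F z - (w - z) * G z)%C with
  ((F w - F z - (u N w - u N z)) + (u N w - u N z - (w - z) * C_derive (u N) z)
   + - ((w - z) * (G z - C_derive (u N) z)))%C by ring.
eapply Rle_trans; [apply Cmod_triangle|]; rewrite Cmod_opp, Cmod_mult.
pose proof (Cmod_triangle (F w - F z - (u N w - u N z))%C
  (u N w - u N z - (w - z) * C_derive (u N) z)%C).
pose proof (Cmod_ge_0 (w - z)%C).
assert (Cmod (w - z)%C * Cmod (G z - C_derive (u N) z)%C <= Cmod (w - z)%C * (e / 3))
  by (apply Rmult_le_compat_l; auto).
lra.
Qed.

(** The candidate limit is the pointwise limit; the norm only sees its value at 0 and its
    derivative, both of which pass to the limit in the Cauchy estimates. *)
Lemma bloch_complete : seq_complete bloch_NormedModule.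
Proof.
intros u Hu.
assert (HF : forall w, exists l, disk w -> Clim (fun n => u n w) l).
{ intros w; destruct (disk_dec w) as [Hw | Hw]; [|exists (RtoC 0); tauto].
  destruct (C_cauchy_lim (fun n => u n w)) as [l Hl]; [|exists l; auto].
  intros e He; pose proof (rho_ge_0 _ (disk_Cmod w Hw)) as Hr.
  destruct (Hu (e / (1 + rho (Cmod w)))) as [N HN]; [apply Rdiv_lt_0_compat; lra|].
  exists N; intros n m Hn Hm; specialize (HN n m Hn Hm).
  pose proof (bloch_eval_bound (minus (u n) (u m)) w Hw) as H.
  rewrite bloch_minus_on in H by auto.
  eapply Rle_lt_trans; [exact H|].
  replace e with ((1 + rho (Cmod w)) * (e / (1 + rho (Cmod w)))) by (field; lra).
  apply Rmult_lt_compat_l; auto; lra. }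
assert (HG : forall w, exists l, disk w -> Clim (fun n => C_derive (u n) w) l).
{ intros w; destruct (disk_dec w) as [Hw | Hw]; [|exists (RtoC 0); tauto].
  destruct (C_cauchy_lim (fun n => C_derive (u n) w)) as [l Hl]; [|exists l; auto].
  intros e He; pose proof (disk_weight w Hw) as Hr.
  destruct (Hu ((1 - Cmod w ^ 2) * e)) as [N HN]; [apply Rmult_lt_0_compat; lra|].
  exists N; intros n m Hn Hm; specialize (HN n m Hn Hm).
  pose proof (bloch_derive_bound (minus (u n) (u m)) w Hw) as H.
  rewrite C_derive_bloch_minus in H by auto.
  apply (Rmult_lt_reg_l (1 - Cmod w ^ 2)); auto; lra. }
destruct (choice _ HF) as [F HF']; destruct (choice _ HG) as [G HG'].
assert (HFG : forall z, disk z -> cderiv F z (G z)).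
{ intros z Hz; apply (bloch_limit_derive u); auto. }
assert (Hlim : forall e, 0 < e -> exists N, forall n, (N <= n)%nat ->
  Cmod (F (RtoC 0) - u n (RtoC 0))%C <= e /\
  forall z, disk z -> (1 - Cmod z ^ 2) * Cmod (G z - C_derive (u n) z)%C <= e).
{ intros e He; destruct (Hu e He) as [N HN]; exists N; intros n Hn; split.
  - apply (Clim_le (fun m => u m (RtoC 0)) _ _ N); [apply HF', disk_0|].
    intros m Hm; pose proof (bloch_eval_bound (minus (u m) (u n)) _ disk_0) as H.
    rewrite bloch_minus_on, Cmod_0, rho_0 in H by apply disk_0.
    specialize (HN m n Hm Hn); lra.
  - intros z Hz; pose proof (disk_weight z Hz) as Hr.
    assert (Hle : Cmod (G z - C_derive (u n) z)%C <= e / (1 - Cmod z ^ 2)).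
    { apply (Clim_le (fun m => C_derive (u m) z) _ _ N); [auto|].
      intros m Hm; pose proof (bloch_derive_bound (minus (u m) (u n)) _ Hz) as H.
      rewrite C_derive_bloch_minus in H by auto.
      specialize (HN m n Hm Hn).
      apply (Rmult_le_reg_l (1 - Cmod z ^ 2)); auto.
      replace ((1 - Cmod z ^ 2) * (e / (1 - Cmod z ^ 2))) with e by (field; lra). lra. }
    apply (Rmult_le_compat_l (1 - Cmod z ^ 2)) in Hle; [|lra].
    replace ((1 - Cmod z ^ 2) * (e / (1 - Cmod z ^ 2))) with e in Hle by (field; lra).
    exact Hle. }
destruct (Hlim 1 Rlt_0_1) as [N1 HN1]; destruct (HN1 N1 (le_n N1)) as [_ HN1'].
destruct (in_bloch_of_derive F G (norm (u N1) + 1)) as [HFb _]; auto.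
{ intros z Hz; specialize (HN1' z Hz).
  pose proof (bloch_derive_bound (u N1) z Hz); pose proof (disk_weight z Hz).
  pose proof (Cmod_triangle (G z - C_derive (u N1) z)%C (C_derive (u N1) z)) as Ht.
  replace (G z - C_derive (u N1) z + C_derive (u N1) z)%C with (G z) in Ht by ring.
  nra. }
exists (to_bloch F HFb); intros e He.
destruct (Hlim (e / 3)) as [N HN]; [lra|].
exists N; intros n Hn; destruct (HN n Hn) as [H1 H2].
rewrite norm_minus_sym.
eapply Rle_lt_trans; [apply (bloch_norm_minus_le _ _ (e / 3) (e / 3))|lra].
- rewrite to_bloch_on by apply disk_0; exact H1.
- intros z Hz.
  replace (C_derive (to_bloch F HFb) z) with (G z); auto.
  symmetry; apply is_C_derive_unique, (derive_ext_disk F); auto.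
  intros; symmetry; apply to_bloch_on; auto.
Qed.

(** * Powers of a unimodular number *)

(** Monic polynomial functions of degree [n], in Horner form. *)
Fixpoint monic (n : nat) (f : C -> C) : Prop :=
  match n with
  | O => forall z, f z = RtoC 1
  | S m => exists c g, monic m g /\ forall z, f z = (z * g z + c)%C
  end.

(** Division by [z - a], by induction along the Horner form. *)
Lemma monic_factor (n : nat) (f : C -> C) (a : C) : monic (S n) f ->
  exists g, monic n g /\ forall z, f z = (f a + (z - a) * g z)%C.
Proof.
revert f; induction n as [|n IH]; intros f [c [g [Hg Hf]]].
- exists g; split; auto; intros z; rewrite !Hf; simpl in Hg; rewrite !Hg; ring.
- destruct (IH g Hg) as [h [Hh Hgh]].
  exists (fun z => z * h z + g a)%C; split.
  + exists (g a), h; auto.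
  + intros z; rewrite !Hf, (Hgh z); ring.
Qed.

Lemma monic_roots (n : nat) (f : C -> C) (l : list C) : monic n f -> NoDup l ->
  (forall x, In x l -> f x = RtoC 0) -> (length l <= n)%nat.
Proof.
revert f l; induction n as [|n IH]; intros f [|a l] Hf Hl H0; simpl; try lia.
- exfalso; apply C1_nz; rewrite <- (Hf a); apply H0; left; auto.
- destruct (monic_factor n f a Hf) as [g [Hg Hfg]].
  inversion Hl as [|? ? Ha Hl']; subst.
  apply le_n_S, (IH g l); auto; intros x Hx.
  assert (E := Hfg x); rewrite (H0 x), (H0 a) in E by (simpl; auto).
  assert (Hxa : (x - a)%C <> RtoC 0).
  { intros E2; apply Ha; replace a with x; auto.
    replace x with (x - a + a)%C by ring; rewrite E2; ring. }
  replace (g x) with (/ (x - a) * ((x - a) * g x))%C by (field; auto).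
  replace ((x - a) * g x)%C with (0 + (x - a) * g x)%C by ring; rewrite <- E; ring.
Qed.

Lemma monic_pow (n : nat) : monic n (fun z => z ^ n)%C.
Proof.
induction n as [|n IH]; [intros z; reflexivity|].
exists (RtoC 0), (fun z => z ^ n)%C; split; auto; intros z; rewrite Cpow_S; ring.
Qed.

Lemma Cpow_diff (zeta : C) (i j : nat) : zeta <> RtoC 0 -> (i <= j)%nat ->
  (zeta ^ i = zeta ^ j)%C -> (zeta ^ (j - i) = 1)%C.
Proof.
intros Hz Hij E.
replace j with (i + (j - i))%nat in E by lia.
rewrite Cpow_add_r in E.
pose proof (Cpow_nz zeta i Hz) as Hn.
replace (zeta ^ (j - i))%C with (/ zeta ^ i * (zeta ^ i * zeta ^ (j - i)))%C by (field; auto).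
rewrite <- E; field; auto.
Qed.

(** The [n] distinct powers of [zeta] exhaust the roots of [z^n - 1]. *)
Lemma unity_root_power (zeta w : C) (n : nat) : zeta <> RtoC 0 -> has_order zeta n ->
  (w ^ n = 1)%C -> exists k, (1 <= k <= n)%nat /\ w = (zeta ^ k)%C.
Proof.
intros Hz [Hn [Hzn Hmin]] Hw; apply NNPP; intros Hno.
assert (Hlen : (length (w :: map (fun k => zeta ^ k)%C (seq 1 n)) <= n)%nat).
{ apply (monic_roots n (fun z => z ^ n - 1)%C).
  - destruct n as [|n]; [lia|].
    exists (- RtoC 1)%C, (fun z => z ^ n)%C; split; [apply monic_pow|].
    intros z; rewrite Cpow_S; ring.
  - constructor.
    + intros Hin; apply in_map_iff in Hin; destruct Hin as [k [Hk Hin]].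
      apply in_seq in Hin; apply Hno; exists k; split; [lia | auto].
    + apply Injective_map_NoDup_in; [|apply seq_NoDup].
      intros i j Hi Hj E; apply in_seq in Hi, Hj.
      destruct (Nat.lt_trichotomy i j) as [H | [H | H]]; auto; exfalso.
      * apply (Hmin (j - i)%nat); [lia | apply Cpow_diff; auto; lia].
      * apply (Hmin (i - j)%nat); [lia | apply Cpow_diff; auto; lia].
  - intros x [<- | Hin]; [rewrite Hw; ring|].
    apply in_map_iff in Hin; destruct Hin as [k [<- _]].
    rewrite <- Cpow_mult_r, Nat.mul_comm, Cpow_mult_r, Hzn, Cpow_1_l; ring. }
simpl in Hlen; rewrite length_map, length_seq in Hlen; lia.
Qed.

Definition cis (t : R) : C := (cos t, sin t).

Lemma cis_pow (t : R) (k : nat) : (cis t ^ k)%C = cis (INR k * t).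
Proof.
induction k as [|k IH].
- simpl INR; rewrite Rmult_0_l; unfold cis; rewrite cos_0, sin_0; reflexivity.
- rewrite Cpow_S, IH, S_INR; replace ((INR k + 1) * t) with (t + INR k * t) by ring.
  unfold cis, Cmult; simpl; rewrite cos_plus, sin_plus; f_equal; ring.
Qed.

Lemma cis_period (t : R) (b : Z) : cis (t + 2 * IZR b * PI) = cis t.
Proof.
assert (Hn : forall s n, cis (s + 2 * INR n * PI) = cis s).
{ intros s n; unfold cis; rewrite cos_period, sin_period; auto. }
destruct (Z_le_gt_dec 0 b) as [Hb | Hb].
- rewrite <- (Z2Nat.id b), <- INR_IZR_INZ by lia; apply Hn.
- rewrite <- (Hn _ (Z.to_nat (- b))), INR_IZR_INZ, Z2Nat.id, opp_IZR by lia.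
  f_equal; ring.
Qed.

Lemma cis_lipschitz (s t : R) : Cmod (cis s - cis t)%C <= 2 * Rabs (s - t).
Proof.
assert (H : forall f df : R -> R, (forall x, derivable_pt_lim f x (df x)) ->
  (forall x, Rabs (df x) <= 1) -> Rabs (f s - f t) <= Rabs (s - t)).
{ intros f df Hd Hb.
  destruct (MVT_gen f t s df) as [c [_ E]].
  - intros x _; apply is_derive_Reals, Hd.
  - intros x _; apply derivable_continuous_pt; exists (df x); apply Hd.
  - rewrite E, Rabs_mult; specialize (Hb c); pose proof (Rabs_pos (s - t)); nra. }
eapply Rle_trans; [apply Cmod_le_abs|].
pose proof (H cos (fun x => - sin x) derivable_pt_lim_cos) as H1.
pose proof (H sin cos derivable_pt_lim_sin) as H2.
change (Rabs (cos s - cos t) + Rabs (sin s - sin t) <= 2 * Rabs (s - t)).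
assert (Rabs (cos s - cos t) <= Rabs (s - t)).
{ apply H1; intros x; rewrite Rabs_Ropp; apply Rabs_le; pose proof (SIN_bound x); lra. }
assert (Rabs (sin s - sin t) <= Rabs (s - t)).
{ apply H2; intros x; apply Rabs_le; pose proof (COS_bound x); lra. }
lra.
Qed.

Lemma unimodular_cis (z : C) : Cmod z = 1 -> exists t, - PI <= t <= PI /\ z = cis t.
Proof.
destruct z as [x y]; intros Hz.
assert (E : x ^ 2 + y ^ 2 = 1).
{ pose proof (Cmod2_alt (x, y)) as H; rewrite Hz in H; simpl in H; simpl; lra. }
assert (Hx : -1 <= x <= 1) by nra.
pose proof (acos_bound x) as Hb.
assert (Hs : sin (acos x) = Rabs y).
{ rewrite sin_acos, <- sqrt_Rsqr_abs by auto; f_equal; unfold Rsqr; lra. }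
destruct (Rle_dec 0 y) as [Hy | Hy].
- exists (acos x); split; [lra|]; unfold cis; rewrite cos_acos, Hs, Rabs_pos_eq by auto.
  reflexivity.
- exists (- acos x); split; [lra|]; unfold cis.
  rewrite cos_neg, sin_neg, cos_acos, Hs, Rabs_left by lra.
  f_equal; ring.
Qed.

(** Dirichlet: among [0, x, ..., N x] two have fractional parts in the same one of [N]
    boxes. *)
Lemma dirichlet_approx (x : R) (N : nat) : (0 < N)%nat ->
  exists (m : nat) (b : Z), (0 < m)%nat /\ Rabs (INR m * x - IZR b) * INR N < 1.
Proof.
intros HN; assert (HN0 : 0 < INR N) by (apply lt_0_INR; auto).
set (f := fun i => frac_part (INR i * x)).
set (box := fun i => Z.to_nat (Int_part (INR N * f i))).
assert (Hf : forall i, 0 <= f i < 1) by (intros i; destruct (base_fp (INR i * x)); unfold f; lra).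
assert (Hbox : forall i, INR (box i) <= INR N * f i < INR (box i) + 1).
{ intros i; specialize (Hf i); unfold box.
  destruct (base_Int_part (INR N * f i)) as [H1 H2].
  assert (0 <= INR N * f i) by (apply Rmult_le_pos; lra).
  assert (-1 < IZR (Int_part (INR N * f i))) by lra.
  assert (Hz : (-1 < Int_part (INR N * f i))%Z) by (apply lt_IZR; lra).
  rewrite INR_IZR_INZ, Z2Nat.id by lia; lra. }
destruct (classic (exists i j, (i < j)%nat /\ box i = box j)) as [[i [j [Hij E]]] | Hno].
- exists (j - i)%nat, (Int_part (INR j * x) - Int_part (INR i * x))%Z; split; [lia|].
  rewrite minus_INR, minus_IZR by lia.
  replace ((INR j - INR i) * x - (IZR (Int_part (INR j * x)) - IZR (Int_part (INR i * x))))
    with (f j - f i) by (unfold f, frac_part; ring).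
  pose proof (Hbox i) as Hi; pose proof (Hbox j) as Hj; rewrite <- E in Hj.
  rewrite <- (Rabs_pos_eq (INR N)), <- Rabs_mult by lra.
  apply Rabs_def1; lra.
- exfalso.
  assert (Hlen : (length (map box (seq 0 (S N))) <= length (seq 0 N))%nat).
  { apply NoDup_incl_length.
    - apply Injective_map_NoDup_in; [|apply seq_NoDup].
      intros i j _ _ E; destruct (Nat.lt_trichotomy i j) as [H | [H | H]]; auto;
        exfalso; apply Hno; [exists i, j | exists j, i]; auto.
    - intros b Hb; apply in_map_iff in Hb; destruct Hb as [i [<- _]].
      apply in_seq; split; [lia|]; apply INR_lt; simpl Nat.add.
      specialize (Hbox i); specialize (Hf i); nra. }
  rewrite length_map, !length_seq in Hlen; lia.
Qed.

(** Some power [zeta^m] is a rotation by a small nonzero angle; its powers walk around the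
    circle in small steps. *)
Lemma infinite_order_dense (zeta lambda : C) (e : R) : Cmod zeta = 1 -> infinite_order zeta ->
  Cmod lambda = 1 -> 0 < e -> exists k, Cmod (zeta ^ k - lambda)%C < e.
Proof.
intros Hz Hinf Hl He.
destruct (unimodular_cis zeta Hz) as [t [_ Ht]].
destruct (unimodular_cis lambda Hl) as [a [Ha Hla]].
pose proof PI_RGT_0 as HPI.
destruct (INR_unbounded (4 * PI / e + 2)) as [N HN].
assert (HN0 : 0 < 4 * PI / e) by (apply Rdiv_lt_0_compat; lra).
destruct (dirichlet_approx (t / (2 * PI)) N) as [m [b [Hm Hb]]].
{ apply INR_lt; simpl INR; lra. }
set (th := INR m * t - 2 * IZR b * PI).
assert (Hth : Rabs th * INR N < 2 * PI).
{ replace th with (2 * PI * (INR m * (t / (2 * PI)) - IZR b)) by (unfold th; field; lra).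
  rewrite Rabs_mult, (Rabs_pos_eq (2 * PI)) by lra.
  apply (Rmult_lt_compat_l (2 * PI)) in Hb; lra. }
assert (Hzm : (zeta ^ m)%C = cis th).
{ rewrite Ht, cis_pow, <- (cis_period th b); f_equal; unfold th; ring. }
assert (Hth0 : th <> 0).
{ intros E; apply (Hinf m Hm); rewrite Hzm, E; unfold cis; rewrite cos_0, sin_0; reflexivity. }
pose proof (Rabs_pos_lt th Hth0) as Hthp.
assert (Hthe : 2 * Rabs th < e).
{ assert (Rabs th * (4 * PI / e) < 2 * PI) by nra.
  apply (Rmult_lt_reg_r (4 * PI / e)); auto.
  replace (e * (4 * PI / e)) with (4 * PI) by (field; lra); lra. }
assert (HthPI : Rabs th < PI) by nra.
(* Adding a full turn in the direction of [th] puts the target angle ahead of [th]. *)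
assert (Hwind : exists l : Z, 1 <= (a + 2 * IZR l * PI) / th).
{ destruct (Rlt_le_dec 0 th) as [Hs | Hs].
  - exists 1%Z; rewrite Rabs_pos_eq in * by lra.
    apply (Rmult_le_reg_r th); auto; unfold Rdiv; rewrite Rmult_assoc, Rinv_l; lra.
  - exists (-1)%Z; rewrite Rabs_left in * by lra.
    apply (Rmult_le_reg_r (- th)); [lra|].
    replace ((a + 2 * -1 * PI) / th * - th) with (2 * PI - a) by (field; auto); lra. }
destruct Hwind as [l Hq]; set (q := (a + 2 * IZR l * PI) / th) in *.
destruct (base_Int_part q) as [Hq1 Hq2].
assert (Hqz : (0 < Int_part q)%Z) by (apply lt_IZR; lra).
exists (m * Z.to_nat (Int_part q))%nat.
rewrite Cpow_mult_r, Hzm, cis_pow, INR_IZR_INZ, Z2Nat.id by lia.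
rewrite Hla, <- (cis_period a l).
eapply Rle_lt_trans; [apply cis_lipschitz|].
replace (a + 2 * IZR l * PI) with (q * th) by (unfold q; field; auto).
rewrite <- Rmult_minus_distr_r, Rabs_mult.
assert (Rabs (IZR (Int_part q) - q) <= 1) by (apply Rabs_le; lra).
nra.
Qed.

(** * The weighted composition operator *)

Lemma bloch_op_wcomp_on (psi phi : C -> C) (H : maps_bloch (wcomp_op psi phi)) (f : bloch)
  (z : C) : disk z -> bloch_op (wcomp_op psi phi) H f z = (psi z * f (phi z))%C.
Proof. intros Hz; exact (to_bloch_on _ _ z Hz). Qed.

Lemma wcomp_isometry (psi phi : C -> C) (Hpsi : isometric_on_bloch (mul_op psi))
  (Hphi : isometric_on_bloch (comp_op phi)) (H : maps_bloch (wcomp_op psi phi)) :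
  (forall z, disk z -> disk (phi z)) ->
  isometry (V := bloch_NormedModule) (bloch_op (wcomp_op psi phi) H).
Proof.
intros Hself.
assert (Hn : forall f : bloch, bloch_norm (bloch_op (wcomp_op psi phi) H f) = bloch_norm f).
{ intros f; unfold bloch_op; rewrite bloch_norm_to_bloch.
  change (wcomp_op psi phi f) with (mul_op psi (comp_op phi f)).
  destruct Hpsi as [_ Hpsi], Hphi as [Hphi1 Hphi2].
  rewrite Hpsi by (apply Hphi1, bloch_in).
  apply Hphi2, bloch_in. }
split; [split|]; auto.
- intros f g; apply bloch_ext; intros z Hz.
  change (bloch_op (wcomp_op psi phi) H (bloch_plus f g) z
    = bloch_plus (bloch_op (wcomp_op psi phi) H f) (bloch_op (wcomp_op psi phi) H g) z).
  rewrite bloch_plus_on, !bloch_op_wcomp_on, bloch_plus_on by auto; ring.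
- intros a f; apply bloch_ext; intros z Hz.
  change (bloch_op (wcomp_op psi phi) H (bloch_scal a f) z
    = bloch_scal a (bloch_op (wcomp_op psi phi) H f) z).
  rewrite bloch_scal_on, !bloch_op_wcomp_on, bloch_scal_on by auto; ring.
- exists 1; split; [lra|]; intros f.
  change (bloch_norm (bloch_op (wcomp_op psi phi) H f) <= 1 * bloch_norm f).
  rewrite Hn; lra.
Qed.

Lemma unimodular_neq_0 (w : C) : Cmod w = 1 -> w <> RtoC 0.
Proof. intros Hw ->; rewrite Cmod_0 in Hw; lra. Qed.

(** Preimages of [psi * g] under the weighted operator are preimages of [g] under
    composition with [phi], so the latter is onto as well. *)
Lemma wcomp_onto_rotation (psi phi : C -> C) (eta : C) (H : maps_bloch (wcomp_op psi phi)) :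
  isometric_on_bloch (mul_op psi) -> isometric_on_bloch (comp_op phi) ->
  analytic phi -> (forall z, disk z -> disk (phi z)) ->
  Cmod eta = 1 -> (forall z, disk z -> psi z = eta) ->
  (forall g : bloch, exists f : bloch, bloch_op (wcomp_op psi phi) H f = g) ->
  is_rotation phi.
Proof.
intros Hpsi Hphi Han Hself Heta Heq Honto.
apply Cmod_preserving_rotation; auto.
apply isometric_comp_onto_Cmod; auto.
intros g Hg.
destruct (Honto (to_bloch (mul_op psi g) (proj1 Hpsi g Hg))) as [h Hh].
exists h; split; [apply bloch_in|]; intros z Hz.
assert (E := f_equal (fun k : bloch => k z) Hh); cbv beta in E.
rewrite bloch_op_wcomp_on, to_bloch_on in E by auto.
unfold mul_op in E; rewrite Heq in E by auto.
pose proof (unimodular_neq_0 eta Heta) as Hn.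
replace (h (phi z)) with (/ eta * (eta * h (phi z)))%C by (field; auto).
rewrite E; field; auto.
Qed.

Lemma disk_rotate (w z : C) : Cmod w = 1 -> disk z -> disk (w * z)%C.
Proof. intros Hw Hz; unfold disk; rewrite Cmod_mult, Hw, Rmult_1_l; exact Hz. Qed.

Lemma in_bloch_rotate (f : C -> C) (w : C) : Cmod w = 1 -> in_bloch f ->
  in_bloch (fun z => f (w * z)%C).
Proof.
intros Hw Hf.
apply (in_bloch_of_derive _ (fun z => w * C_derive f (w * z))%C (beta f)).
- intros z Hz; apply (cderiv_comp f (fun z => w * z)%C).
  + apply analytic_derive; [apply Hf | apply disk_rotate; auto].
  + apply cderiv_linear.
- intros z Hz; pose proof (seminorm_ge f _ Hf (disk_rotate w z Hw Hz)) as H.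
  rewrite !Cmod_mult, Hw, !Rmult_1_l in *; exact H.
Qed.

Lemma wcomp_rotation_onto (psi phi : C -> C) (eta zeta : C)
  (H : maps_bloch (wcomp_op psi phi)) : Cmod eta = 1 -> Cmod zeta = 1 ->
  (forall z, disk z -> psi z = eta) -> (forall z, disk z -> phi z = (zeta * z)%C) ->
  forall g : bloch, exists f : bloch, bloch_op (wcomp_op psi phi) H f = g.
Proof.
intros Heta Hzeta Hpsi Hphi g.
pose proof (unimodular_neq_0 eta Heta) as He; pose proof (unimodular_neq_0 zeta Hzeta) as Hz.
assert (Hinv : Cmod (/ zeta)%C = 1) by (rewrite Cmod_inv, Hzeta by auto; apply Rinv_1).
assert (Hf := proj1 (bloch_scal_spec (/ eta)%C _
  (in_bloch_rotate g (/ zeta)%C Hinv (bloch_in g)))).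
exists (to_bloch _ Hf); apply bloch_ext; intros z Hzd.
rewrite bloch_op_wcomp_on, Hpsi, Hphi, to_bloch_on by (auto using disk_rotate).
replace (/ zeta * (zeta * z))%C with z by (field; auto).
field; auto.
Qed.

Lemma wcomp_rotation_iter (psi phi : C -> C) (eta zeta : C)
  (H : maps_bloch (wcomp_op psi phi)) : Cmod zeta = 1 ->
  (forall z, disk z -> psi z = eta) -> (forall z, disk z -> phi z = (zeta * z)%C) ->
  forall (n : nat) (f : bloch) (z : C), disk z ->
  Nat.iter n (bloch_op (wcomp_op psi phi) H) f z = (eta ^ n * f (zeta ^ n * z))%C.
Proof.
intros Hzeta Hpsi Hphi; induction n as [|n IH]; intros f z Hz.
- simpl; rewrite !Cmult_1_l; reflexivity.
- rewrite Nat.iter_succ, bloch_op_wcomp_on, Hpsi, Hphi, IH by (auto using disk_rotate).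
  rewrite !Cpow_S.
  replace (zeta * zeta ^ n * z)%C with (zeta ^ n * (zeta * z))%C by ring; ring.
Qed.

Definition monomial (k : nat) : bloch := to_bloch _ (in_bloch_pow k).

Lemma monomial_norm_pos (k : nat) : 0 < norm (monomial k).
Proof.
destruct (norm_ge_0 (monomial k)) as [H | H]; auto; exfalso.
symmetry in H; apply bloch_norm_eq_0 in H.
assert (Hd : disk (RtoC (1 / 2))) by (unfold disk; rewrite Cmod_R, Rabs_pos_eq; lra).
assert (E := f_equal (fun f : bloch => f (RtoC (1 / 2))) H); cbv beta in E.
unfold monomial in E; rewrite to_bloch_on, bloch_zero_on in E by auto.
apply (Cpow_nz (RtoC (1 / 2)) k); auto.
intros E2; apply RtoC_inj in E2; lra.
Qed.

Lemma wcomp_rotation_monomial (psi phi : C -> C) (eta zeta lambda : C)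
  (H : maps_bloch (wcomp_op psi phi)) : Cmod zeta = 1 ->
  (forall z, disk z -> psi z = eta) -> (forall z, disk z -> phi z = (zeta * z)%C) ->
  forall k, norm (shifted (bloch_op (wcomp_op psi phi) H) lambda (monomial k))
            = Cmod (eta * zeta ^ k - lambda)%C * norm (monomial k).
Proof.
intros Hzeta Hpsi Hphi k.
rewrite <- (norm_scal_C bloch_NormedModule); f_equal.
apply bloch_ext; intros z Hz.
rewrite bloch_minus_on by auto.
change (bloch_op (wcomp_op psi phi) H (monomial k) z - bloch_scal lambda (monomial k) z
  = bloch_scal (eta * zeta ^ k - lambda) (monomial k) z)%C.
rewrite !bloch_scal_on, bloch_op_wcomp_on, Hpsi, Hphi by auto.
unfold monomial; rewrite !to_bloch_on, Cpow_mult_l by (auto using disk_rotate); ring.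
Qed.

Theorem theorem5p4 (psi phi : C -> C)
  (psi_an : analytic psi)
  (psi_iso : isometric_on_bloch (mul_op psi))
  (phi_an : analytic phi)
  (phi_self : forall z, disk z -> disk (phi z))
  (phi_iso : isometric_on_bloch (comp_op phi)) :
  let W : bloch -> bloch :=
    bloch_op (wcomp_op psi phi) (wcomp_maps psi phi psi_iso phi_iso) in
  exists eta : C,
    Cmod eta = 1%R /\ (forall z, disk z -> psi z = eta) /\
    (~ is_rotation phi ->
       forall lambda : C, spectrum W lambda <-> (Cmod lambda <= 1)%R) /\
    (forall zeta : C, Cmod zeta = 1%R ->
       (forall z, disk z -> phi z = (zeta * z)%C) ->
       (infinite_order zeta ->
          forall lambda : C, spectrum W lambda <-> Cmod lambda = 1%R) /\
       (forall n : nat, has_order zeta n ->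
          forall lambda : C, spectrum W lambda <->
            exists k : nat, (1 <= k <= n)%nat /\ lambda = (eta * Cpow zeta k)%C)).
Proof.
intros W.
destruct (isometric_mul_const psi psi_iso) as [eta [Heta Hpsi]].
assert (Hiso : isometry (V := bloch_NormedModule) W) by (apply wcomp_isometry; auto).
pose proof (unimodular_neq_0 eta Heta) as Heta0.
exists eta; split; [|split; [|split]]; auto.
{ intros Hrot; apply spectrum_isometry_not_onto; [apply bloch_complete | auto |].
  intros Honto; apply Hrot.
  apply (wcomp_onto_rotation psi phi eta (wcomp_maps psi phi psi_iso phi_iso)); auto. }
intros zeta Hzeta Hphi.
pose proof (unimodular_neq_0 zeta Hzeta) as Hzeta0.
assert (Honto : forall g : bloch, exists f, W f = g)
  by (apply (wcomp_rotation_onto psi phi eta zeta); auto).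
assert (Hmono : forall lambda k, norm (shifted W lambda (monomial k))
  = Cmod (eta * zeta ^ k - lambda)%C * norm (monomial k))
  by (intros; apply wcomp_rotation_monomial; auto).
split.
- intros Hinf lambda; split.
  + apply spectrum_isometry_onto; [apply bloch_complete | auto | auto].
  + intros Hl; apply approx_eigenvalue_spectrum; intros e He.
    destruct (infinite_order_dense zeta (lambda / eta)%C e) as [k Hk]; auto.
    { rewrite Cmod_div, Hl, Heta by auto; field. }
    exists (monomial k); split; [apply monomial_norm_pos|].
    rewrite Hmono; apply Rmult_le_compat_r; [apply norm_ge_0|].
    replace (eta * zeta ^ k - lambda)%C with (eta * (zeta ^ k - lambda / eta))%C
      by (field; auto).
    rewrite Cmod_mult, Heta; lra.
- intros n Hn lambda; split.
  + intros Hl; apply NNPP; intros Hno; apply Hl.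
    apply (scalar_power_shift_invertible bloch_NormedModule W lambda (eta ^ n)%C n).
    * apply Hiso.
    * intros f; apply bloch_ext; intros z Hz.
      transitivity (eta ^ n * f (zeta ^ n * z))%C.
      { apply wcomp_rotation_iter; auto. }
      destruct Hn as [_ [-> _]]; rewrite Cmult_1_l.
      symmetry; apply bloch_scal_on; auto.
    * intros E; destruct (unity_root_power zeta (lambda / eta)%C n) as [k [Hk Ek]]; auto.
      { unfold Cdiv; rewrite Cpow_mult_l, Cpow_inv, E by auto.
        field; apply Cpow_nz; auto. }
      apply Hno; exists k; split; auto; rewrite <- Ek; field; auto.
  + intros [k [_ ->]]; apply approx_eigenvalue_spectrum; intros e He.
    exists (monomial k); split; [apply monomial_norm_pos|].
    rewrite Hmono.
    replace (eta * zeta ^ k - eta * zeta ^ k)%C with (RtoC 0) by ring.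
    rewrite Cmod_0, Rmult_0_l; apply Rmult_le_pos; [lra | apply norm_ge_0].
Qed.
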